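(* Let $u:\mathbf{R}^n\to\mathbf{R}$ be a bounded pointwise stable classical solution of $$-\operatorname{div}(\gamma(\mathbf x')\nabla u(\mathbf x))=\lambda(\mathbf x')f(u(\mathbf x)),\qquad \mathbf x=(\mathbf x',\mathbf x'')\in\mathbf{R}^d\times\mathbf{R}^s=\mathbf{R}^n,$$ where $f\in C^1(\mathbf R)$. Suppose that either $f(t)\ge 0$ for all $t$ in the range of $u$, or $t f(t)\le 0$ for all $t$ in the range of $u$. Suppose moreover that there are $g\in\mathcal G$ and a constant $k$ independent of $R$ such that either $$\int_{B_{2R}}\gamma(\mathbf x')\,d\mathbf x'\le k\,g(R)\ \text{ for all } R>1\quad\text{and}\quad n\le d+4,$$ or $$\int_{B_{2R}}\gamma(\mathbf x')\,d\mathbf x'\le k\,R\,g(R)\ \text{ for all } R>1\quad\text{and}\quad n\le d+3,$$ where $B_{2R}$ is the ball of radius $2R$ centered at the origin in $\mathbf R^d$. Then $u$ is constant.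
   Context: Here $d,s\ge 1$ are integers and $n=d+s$. The weights $\gamma,\lambda$ are smooth functions on $\mathbf R^d$ with $\gamma>0$ and $\lambda>0$ (except that $\lambda$ is allowed to vanish, say, at a point). The class $\mathcal G$ is the set of nondecreasing functions $g:\mathbf R^+\to\mathbf R^+$ with $\int_1^\infty \frac{1}{r g(r)}\,dr=\infty$. A classical solution $u$ is called pointwise stable if there exists a function $v>0$ on $\mathbf R^n$ satisfying the linearized equation $-\operatorname{div}(\gamma(\mathbf x')\nabla v)=\lambda(\mathbf x')f'(u)v$ for all $\mathbf x\in\mathbf R^n$. *)

(* Defs.v *)
From HB Require Import structures.
From mathcomp Require Import all_boot all_order all_algebra.
From mathcomp Require Import all_classical all_reals all_analysis.

Set Implicit Arguments.
Unset Strict Implicit.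
Unset Printing Implicit Defensive.
Import Order.TTheory GRing.Theory Num.Theory.
Import numFieldNormedType.Exports.

Local Open Scope classical_set_scope.
Local Open Scope ring_scope.

(* Lebesgue measure on R^n lives on the type of n-tuples, which the library
   equips with the product sigma-algebra: it is the iterated product of the
   one-dimensional Lebesgue measure, transported along (t, y) |-> t :: y. *)

Section lebesgue_cons.
Context (R : realType) (n : nat).
Local Notation mR := (measurableTypeR R).
Variable mu : {sigma_finite_measure set (n.-tuple mR) -> \bar R}.

Definition tuple_cons (z : mR * n.-tuple mR) : n.+1.-tuple mR :=
  [tuple of z.1 :: z.2].

Definition tuple_uncons (t : n.+1.-tuple mR) : mR * n.-tuple mR :=
  (thead t, [tuple of behead t]).

Lemma tuple_consK : cancel tuple_cons tuple_uncons.
Proof.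
by case=> t y; rewrite /tuple_uncons /tuple_cons theadE; congr pair; exact: val_inj.
Qed.

Lemma tuple_unconsK : cancel tuple_uncons tuple_cons.
Proof. by move=> t; rewrite [RHS]tuple_eta. Qed.

Lemma measurable_tuple_cons : measurable_fun setT tuple_cons.
Proof. exact: measurable_cons. Qed.

Lemma measurable_tuple_uncons : measurable_fun setT tuple_uncons.
Proof.
apply/measurable_fun_pair; last exact: measurable_behead.
exact: (@measurable_tnth _ mR n.+1 ord0).
Qed.

Definition lebesgue_cons : set (n.+1.-tuple mR) -> \bar R :=
  pushforward (@lebesgue_measure R \x mu)%E tuple_cons.

HB.instance Definition _ :=
  isMeasurableFun.Build _ _ _ _ tuple_cons measurable_tuple_cons.

Let lebesgue_cons0 : lebesgue_cons set0 = 0%E.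
Proof. exact: measure0. Qed.

Let lebesgue_cons_ge0 A : (0 <= lebesgue_cons A)%E.
Proof. exact: measure_ge0. Qed.

Let lebesgue_cons_sigma_additive : semi_sigma_additive lebesgue_cons.
Proof. exact: measure_semi_sigma_additive. Qed.

HB.instance Definition _ := isMeasure.Build _ _ _ lebesgue_cons
  lebesgue_cons0 lebesgue_cons_ge0 lebesgue_cons_sigma_additive.

Let lebesgue_cons_sigma_finite : sigma_finite setT lebesgue_cons.
Proof.
have /sigma_finiteP[F [TF ndF Foo]] := sigma_finiteT (@lebesgue_measure R).
have /sigma_finiteP[G [TG ndG Goo]] := sigma_finiteT mu.
exists (fun k => tuple_uncons @^-1` (F k `*` G k)) => [|k].
  rewrite -preimage_bigcup -[LHS](preimage_setT tuple_uncons); congr preimage.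
  apply/esym; rewrite -subTset => -[x y] _.
  have [k _ Fkx] : (\bigcup_k F k) x by rewrite -TF.
  have [l _ Gly] : (\bigcup_k G k) y by rewrite -TG.
  exists (maxn k l) => //; split.
  - by move: x Fkx; exact/subsetPset/ndF/leq_maxl.
  - by move: y Gly; exact/subsetPset/ndG/leq_maxr.
have [mF Fk] := Foo k; have [mG Gk] := Goo k; split.
  rewrite -[X in measurable X]setTI; apply: measurable_tuple_uncons => //.
  exact: measurableX.
rewrite /lebesgue_cons /pushforward -comp_preimage.
rewrite (_ : tuple_uncons \o tuple_cons = id); last first.
  by apply/funext => z /=; rewrite tuple_consK.
by rewrite preimage_id product_measure1E// lte_mul_pinfty// ge0_fin_numE.
Qed.

HB.instance Definition _ := Measure_isSigmaFinite.Build _ _ _ lebesgue_cons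
  lebesgue_cons_sigma_finite.

End lebesgue_cons.

Fixpoint lebesgue_tuple (R : realType) (n : nat) :
    {sigma_finite_measure set (n.-tuple (measurableTypeR R)) -> \bar R} :=
  match n with
  | 0 => \d_([tuple] : 0.-tuple (measurableTypeR R))
  | m.+1 => lebesgue_cons (lebesgue_tuple R m)
  end.

(* Points of R^n are row vectors.  The norm that the library puts on row vectors
   is the sup norm (equivalent to the Euclidean one, so continuity and
   derivatives are the usual ones); balls are Euclidean, so they are spelled
   out. *)
Definition ball_integral (R : realType) (n : nat) (w : 'rV[R]_n -> R) (r : R) :
    \bar R :=
  (\int[lebesgue_tuple R n]_(t in [set t | \sum_(i < n) tnth t i ^+ 2 < r ^+ 2]%R)
     (w (\row_i tnth t i))%:E)%E.

Definition partial (R : realType) (n : nat) (i : 'I_n) (w : 'rV[R]_n -> R) :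
    'rV[R]_n -> R :=
  fun x => 'D_(delta_mx 0 i) w x.

Fixpoint class_C (R : realType) (n k : nat) (w : 'rV[R]_n -> R) : Prop :=
  continuous w /\
  match k with
  | 0 => True
  | m.+1 => forall i : 'I_n,
      (forall x, derivable w x (delta_mx 0 i)) /\ class_C m (partial i w)
  end.

Definition smooth (R : realType) (n : nat) (w : 'rV[R]_n -> R) : Prop :=
  forall k, class_C k w.

(* div (gamma(x') grad w), with x' = lsubmx x the first d coordinates. *)
Definition weighted_div_grad (R : realType) (d s : nat) (gamma : 'rV[R]_d -> R)
    (w : 'rV[R]_(d + s) -> R) (x : 'rV[R]_(d + s)) : R :=
  \sum_(i < d + s) partial i (fun y => gamma (lsubmx y) * partial i w y) x.

Definition classical_solution (R : realType) (d s : nat)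
    (gamma lambda : 'rV[R]_d -> R) (f : R -> R) (u : 'rV[R]_(d + s) -> R) : Prop :=
  class_C 2 u /\
  forall x, - weighted_div_grad gamma u x = lambda (lsubmx x) * f (u x).

Definition pointwise_stable (R : realType) (d s : nat)
    (gamma lambda : 'rV[R]_d -> R) (f : R -> R) (u : 'rV[R]_(d + s) -> R) : Prop :=
  exists v : 'rV[R]_(d + s) -> R,
    [/\ class_C 2 v, forall x, 0 < v x &
        forall x, - weighted_div_grad gamma v x
                  = lambda (lsubmx x) * derive1 f (u x) * v x].

(* Only the values of g on (0, +oo) matter, and g may vanish there, so that both
   readings of R^+ are covered.  The library sets 0^-1 = 0, so an interval on
   which g = 0 contributes nothing to the integral. *)
Definition class_G (R : realType) (g : R -> R) : Prop :=
  [/\ forall r, 0 < r -> 0 <= g r,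
      forall r r', 0 < r -> r <= r' -> g r <= g r' &
      (\int[@lebesgue_measure R]_(r in `[1%R, +oo[) ((r * g r)^-1)%:E = +oo)%E].

(* Main.v *)
Require Import Defs.
From mathcomp Require Import all_boot all_order all_algebra.
From mathcomp Require Import all_classical all_reals all_analysis.
From mathcomp Require Import measurable_realfun ring lra.
Import Order.TTheory GRing.Theory Num.Theory.
Import numFieldNormedType.Exports.
Set Implicit Arguments.
Unset Strict Implicit.
Unset Printing Implicit Defensive.

Local Open Scope classical_set_scope.
Local Open Scope ring_scope.

(** The proof combines an energy inequality, cutoff functions of small Dirichlet
energy, and a comparison of the derivatives of u with the positive function v
given by stability.

Energy. Let m be an upper bound of u if f >= 0, and m = 0 if t f(t) <= 0. Then
f(u) (u - m) <= 0, so testing the equation with (u - m) phi^2 bounds the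
integral of gamma |grad u|^2 phi^2 by a constant times that of
gamma |grad phi|^2 ([caccioppoli]). Since gamma depends on the first d variables
only, its mass in the ball of radius R of R^(d+s) is at most (2R)^s times its
mass in the ball of R^d, that is O(R^4 g(R)) under either growth hypothesis
([growth_mass_le]). Therefore gamma |grad u|^2 has mass O(R^2 g(R))
([mass_le_gradient]).

Parabolicity. The growth R^2 g(R), with the integral of 1/(r g(r)) divergent,
makes a weight parabolic: the series of the 1/g(2^k) diverges
([class_G_series]), and the average of dyadic bumps weighted by 1/g(2^k) is a
cutoff, equal to 1 on any prescribed ball, of arbitrarily small Dirichlet energy
([log_cutoff]).

Rigidity. The coefficients do not depend on the last s variables, so a derivative
u_j in one of these directions solves weakly the linearized equation
([weak_linearized]), which v solves too. Comparing the two equations, the integral of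
gamma v^2 |grad (phi u_j / v)|^2 equals that of gamma u_j^2 |grad phi|^2, and the
latter can be made arbitrarily small. Hence u_j = c_j v ([stable_liouville]).

Conclusion. The last s derivatives of u being proportional to each other, u
restricted to the first d variables and one more solves an equation of the same
kind with a constant coefficient kappa in the last direction. In dimension d + 1
gamma itself has mass O(R^2 g(R)), so the energy inequality and the cutoffs force
the energy of u to vanish on every such slice ([energy_liouville]). *)

Definition row_of_tuple (R : realType) (n : nat) (t : n.-tuple (measurableTypeR R)) : 'rV[R]_n :=
  \row_i tnth t i.

Definition sqnorm (R : realType) (n : nat) (x : 'rV[R]_n) : R := \sum_(i < n) x 0 i ^+ 2.

(** * Measurability and iterated integrals on tuples *)

Section meas.
Context {R : realType}.
Notation mR := (measurableTypeR R).

(** Tuples carry the product sigma-algebra, while continuity refers to row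
vectors. Rounding every coordinate down to a multiple of 1/(k+1) gives a map
with countably many values, hence a measurable composite, and these composites
converge pointwise. *)
Lemma measurable_row_of_tuple n (F : 'rV[R]_n -> R) : continuous F ->
  measurable_fun [set: n.-tuple mR] (fun t : n.-tuple mR => F (row_of_tuple t)).
Proof.
move=> cF.
pose fl k (x : R) : R := (Num.floor (x * k.+1%:R))%:~R / k.+1%:R.
apply: (@measurable_fun_cvg _ _ _ _ (fun k t => F (\row_i fl k (tnth t i)))).
  move=> k; pose G (z : n.-tuple int) := F (\row_i ((tnth z i)%:~R / k.+1%:R)).
  move=> _ Y _; rewrite setTI.
  rewrite [X in measurable X](_ : _ = \bigcup_(z : n.-tuple int)
     [set t : n.-tuple mR | Y (G z) /\ forall i, Num.floor ((tnth t i) * k.+1%:R) = tnth z i]).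
    apply: countable_bigcupT_measurable => // z.
    have [Yz|Yz] := pselect (Y (G z)); last first.
      by rewrite [X in measurable X](_ : _ = set0)// -subset0 => t [].
    rewrite [X in measurable X](_ : _ = \bigcap_(i in [set: 'I_n])
      (@tnth n mR ^~ i @^-1` [set x : mR | Num.floor (x * k.+1%:R) = tnth z i])).
      apply: fin_bigcap_measurable => // i _.
      rewrite -[X in measurable X]setTI.
      apply: (@measurable_tnth _ mR n i) => //.
      rewrite [X in measurable X](_ : _ = [set` `[((tnth z i)%:~R / k.+1%:R : R),
        ((tnth z i + 1)%:~R / k.+1%:R : R)[ ])//.
      apply/seteqP; split => x /=; rewrite in_itv /= ler_pdivrMr ?ltr_pdivlMr//.
        by move=> <-; rewrite floor_le_tmp floorD1_gt.
      by move=> h; apply/floor_def.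
    apply/seteqP; split => t /=; first by move=> [_ h] i _; exact: h.
    by move=> h; split => // i; exact: h.
  apply/seteqP; split => t /=.
    move=> Yt; exists [tuple Num.floor (tnth t i * k.+1%:R) | i < n] => //=.
    split; last by move=> i; rewrite tnth_mktuple.
    rewrite /G; move: Yt; congr (Y (F _)); apply/rowP => i.
    by rewrite !mxE tnth_mktuple.
  move=> [z _ [Yz h]]; move: Yz; rewrite /G; congr (Y (F _)); apply/rowP => i.
  by rewrite !mxE /fl h.
move=> t _.
have cv : (\row_i fl k (tnth t i)) @[k --> \oo] --> row_of_tuple t; last first.
  exact: (cvg_comp _ _ cv (cF (row_of_tuple t))).
apply/cvg_ballP => e e0; near=> k; split=> // a b; rewrite !mxE.
rewrite /ball /= /fl -(mulfK (x := k.+1%:R) _ (tnth t b)) ?pnatr_eq0// -mulrBl normrM.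
rewrite (ger0_norm (x := _^-1))//.
apply: le_lt_trans (_ : 1 * k.+1%:R^-1 < e).
  rewrite ler_wpM2r// mulfK ?pnatr_eq0//.
  have := floor_le_tmp (tnth t b * k.+1%:R); have := ltW (floorD1_gt (tnth t b * k.+1%:R)).
  rewrite intrD => h1 h2; rewrite ger0_norm; lra.
by rewrite mul1r; near: k; exact: (near_infty_natSinv_lt (PosNum e0)).
Unshelve. all: by end_near.
Qed.

End meas.

Section peel.
Context {R : realType}.
Notation mR := (measurableTypeR R).
Notation leb := (@lebesgue_measure R).

Lemma tonelli_cons n (G : n.+1.-tuple mR -> \bar R) :
  measurable_fun [set: n.+1.-tuple mR] G -> (forall t, 0 <= G t)%E ->
  (\int[lebesgue_tuple R n.+1]_t G t =
   \int[leb]_x \int[lebesgue_tuple R n]_y G (tuple_cons (x, y)))%E.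
Proof.
move=> mG G0.
rewrite [LHS](ge0_integral_pushforward (@measurable_tuple_cons R n) (leb \x lebesgue_tuple R n)%E)//.
rewrite preimage_setT.
rewrite fubini_tonelli1//=.
exact: (measurableT_comp mG (@measurable_tuple_cons R n)).
Qed.

Lemma fubini_cons n (G : n.+1.-tuple mR -> \bar R) :
  (lebesgue_tuple R n.+1).-integrable setT G ->
  (\int[lebesgue_tuple R n.+1]_t G t =
   \int[leb]_x \int[lebesgue_tuple R n]_y G (tuple_cons (x, y)))%E /\
  (\int[lebesgue_tuple R n.+1]_t G t =
   \int[lebesgue_tuple R n]_y \int[leb]_x G (tuple_cons (x, y)))%E.
Proof.
move=> iG; have mG := measurable_int _ iG.
have mGc : measurable_fun setT (G \o @tuple_cons R n).
  exact: (measurableT_comp mG (@measurable_tuple_cons R n)).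
have iGc : (leb \x lebesgue_tuple R n)%E.-integrable setT (G \o @tuple_cons R n).
  apply/integrableP; split=> //.
  move/integrableP: iG => [_]; apply: le_lt_trans.
  rewrite [leRHS](ge0_integral_pushforward (@measurable_tuple_cons R n) (leb \x lebesgue_tuple R n)%E)//.
  exact: measurableT_comp.
have E : (\int[lebesgue_tuple R n.+1]_t G t = \int[(leb \x lebesgue_tuple R n)]_z G (tuple_cons z))%E.
  rewrite [LHS](integral_pushforward (@measurable_tuple_cons R n))//.
split; rewrite E.
  by rewrite -(integral12_prod_meas1 iGc).
by rewrite -(integral12_prod_meas1 iGc) (Fubini iGc).
Qed.

Definition cube n (c : 'I_n -> R) (r : R) : set (n.-tuple mR) :=
  [set t | forall i, `|tnth t i - c i| <= r].

Lemma measurable_cube n (c : 'I_n -> R) r : measurable (cube c r).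
Proof.
rewrite (_ : cube c r = \bigcap_(i in [set: 'I_n])
   (@tnth n mR ^~ i @^-1` [set` `[c i - r, c i + r]])); last first.
  apply/seteqP; split => t /= h i; first by move=> _ /=; rewrite in_itv/= -ler_distl; exact: h.
  by rewrite ler_distl; have := h i Logic.I; rewrite /= in_itv.
apply: fin_bigcap_measurable => // i _.
rewrite -[X in measurable X]setTI.
exact: (@measurable_tnth _ mR n i).
Qed.

Lemma lebesgue_cube n (c : 'I_n -> R) r : 0 < r ->
  lebesgue_tuple R n (cube c r) = ((2 * r) ^+ n)%:E.
Proof.
move=> r0; elim: n c => [|n IH] c.
  rewrite /= diracE mem_set ?expr0// => -[]//.
rewrite /= /lebesgue_cons /pushforward.
rewrite (_ : _ @^-1` _ = [set` `[c ord0 - r, c ord0 + r]] `*` cube (c \o lift ord0) r); last first.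
  apply/seteqP; split => -[x y] /=.
    move=> h; split; first by have := h ord0; rewrite ler_distl in_itv/= => ->.
    by move=> i; have := h (lift ord0 i); rewrite tnthS.
  rewrite in_itv /= -ler_distl => -[hx hy] i.
  case: (unliftP ord0 i) => [j ->|->]; first by rewrite tnthS; exact: hy.
  by [].
rewrite product_measure1E//; last exact: measurable_cube.
rewrite IH /= lebesgue_measure_itv /= lte_fin ltrBlDr -addrA ltrDl addr_gt0//.
by rewrite -EFinD -EFinM exprS; congr (_ * _)%:E; ring.
Qed.

End peel.

(** * Integral of compactly supported continuous functions *)

Section cc.
Context {R : realType}.
Notation mR := (measurableTypeR R).

(** The support is controlled by the squared Euclidean norm because all cutoffs
are functions of [sqnorm]. *)
Definition ccont n (F : 'rV[R]_n -> R) : Prop :=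
  continuous F /\ exists L, forall x, L <= sqnorm x -> F x = 0.

(** Real-valued, so that the energy identities below can be manipulated by linear
arithmetic; it is meaningful on [ccont] functions. *)
Definition Rn_int n (F : 'rV[R]_n -> R) : R := (\int[lebesgue_tuple R n]_t F (row_of_tuple t))%R.

Lemma sqnorm_ge0 n (x : 'rV[R]_n) : 0 <= sqnorm x.
Proof. by apply: sumr_ge0 => i _; rewrite sqr_ge0. Qed.

Lemma sqr_coord_le n (x : 'rV[R]_n) i : x 0 i ^+ 2 <= sqnorm x.
Proof. by rewrite /sqnorm (bigD1 i)//= lerDl sumr_ge0// => j _; rewrite sqr_ge0. Qed.

Lemma coord_le n (x : 'rV[R]_n) i r : 0 <= r -> sqnorm x <= r ^+ 2 -> `|x 0 i| <= r.
Proof.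
move=> r0 Qr; rewrite -(ler_pXn2r (n := 2))// ?nnegrE//.
by rewrite real_normK ?num_real//; exact: le_trans (sqr_coord_le x i) Qr.
Qed.

Lemma sqr_bound (L : R) : exists2 r, 0 < r & L <= r ^+ 2.
Proof.
exists (`|L| + 1); first by rewrite ltr_wpDl.
have := ler_norm L; have := normr_ge0 L; nra.
Qed.

Lemma continuous_bounded n (F : 'rV[R]_n -> R) (r : R) : continuous F ->
  exists2 M, 0 <= M & forall x : 'rV[R]_n, (forall i, `|x 0 i| <= r) -> `|F x| <= M.
Proof.
move=> cF; have [r0|r0] := ltP r 0.
  case: n F cF => [|n] F cF; last first.
    by exists 0 => // x /(_ ord0) h; have := le_trans (normr_ge0 _) h; rewrite leNgt r0.
  exists `|F 0| => // x _; by rewrite (_ : x = 0)//; apply/rowP => -[].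
pose K := [set v : 'rV[R]_n | forall i : 'I_n, [set` `[- r, r]] (v ord0 i)].
have cK : compact K by exact: (@rV_compact R n (fun=> [set` `[- r, r]]) (fun=> @segment_compact R (- r) r)).
have K0 : K !=set0.
  by exists 0 => i /=; rewrite mxE in_itv/= oppr_le0 r0.
have cnF : {within K, continuous (fun x => `|F x|)}.
  apply: continuous_subspaceT => x; apply: continuous_comp; first exact: cF.
  exact: norm_continuous.
have [c _ hc] := compact_EVT_max K0 cK cnF.
exists `|F c| => // x hx; apply: hc; rewrite inE => i /=.
by rewrite in_itv /= -ler_norml.
Qed.

Lemma ccont_bounded n (F : 'rV[R]_n -> R) : ccont F -> exists M, forall x, `|F x| <= M.
Proof.
move=> [cF [L hL]]; have [r r0 Lr] := sqr_bound L.
have [M M0 hM] := @continuous_bounded n F r cF.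
exists M => x; have [h|/ltW h] := leP (sqnorm x) (r ^+ 2).
  by apply: hM => i; apply: coord_le => //; exact: ltW.
by rewrite hL ?normr0//; exact: le_trans Lr h.
Qed.

(** The dominating functions are constants on cubes, whose measure is explicit;
this passes from Euclidean balls to cubes. *)
Lemma cube_support n (F : 'rV[R]_n -> R) L : (forall x, L <= sqnorm x -> F x = 0) ->
  exists2 r, 0 < r & forall t : n.-tuple mR, ~ cube (fun=> 0) r t -> F (row_of_tuple t) = 0.
Proof.
move=> hL; have [r r0 Lr] := sqr_bound L; exists r => // t nbt.
apply: hL; apply: (le_trans Lr); rewrite leNgt; apply/negP => h; apply: nbt => i.
by have := coord_le i (ltW r0) (ltW h); rewrite mxE subr0.
Qed.

Lemma cst_cube_integrable n (c : 'I_n -> R) (M r : R) : 0 < r ->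
  (lebesgue_tuple R n).-integrable setT (EFin \o (cst M \_ (cube c r))).
Proof.
move=> r0; rewrite -restrict_EFin; apply/(integrable_mkcond _ (measurable_cube c r)).
apply: measurable_bounded_integrable => //; first exact: measurable_cube.
  by rewrite /= lebesgue_cube// ltry.
apply: bounded_cst.
Qed.

Lemma ccont_integrable n (F : 'rV[R]_n -> R) : ccont F ->
  (lebesgue_tuple R n).-integrable setT (EFin \o (fun t => F (row_of_tuple t))).
Proof.
move=> ccF; have [M hM] := ccont_bounded ccF.
have [cF [L hL]] := ccF; have [r r0 hr] := cube_support hL.
apply: (@le_integrable _ _ _ (lebesgue_tuple R n) setT measurableT _ _ _ _
   (cst_cube_integrable (fun=> 0) M r0)).
  by apply/measurable_EFinP; exact: measurable_row_of_tuple.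
move=> t _ /=; rewrite lee_fin patchE; case: ifPn => [_|].
  by apply: le_trans (hM _) _; exact: ler_norm.
by rewrite notin_setE => /hr ->; rewrite !normr0.
Qed.

Section lin.
Variable n : nat.
Implicit Types F G : 'rV[R]_n -> R.

Lemma Rn_intD F G : ccont F -> ccont G -> Rn_int (fun x => F x + G x) = Rn_int F + Rn_int G.
Proof.
by move=> cF cG; rewrite /Rn_int (RintegralD measurableT (ccont_integrable cF) (ccont_integrable cG)).
Qed.

Lemma Rn_intZ a F : ccont F -> Rn_int (fun x => a * F x) = a * Rn_int F.
Proof. by move=> cF; rewrite /Rn_int (RintegralZl a measurableT (ccont_integrable cF)). Qed.

Lemma le_Rn_int F G : ccont F -> ccont G -> (forall x, F x <= G x) -> Rn_int F <= Rn_int G.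
Proof.
move=> cF cG FG; rewrite /Rn_int.
apply: (le_Rintegral measurableT (ccont_integrable cF) (ccont_integrable cG)).
by move=> t _; exact: FG.
Qed.

Lemma eq_Rn_int F G : (forall x, F x = G x) -> Rn_int F = Rn_int G.
Proof. by move=> FG; congr Rn_int; apply/funext. Qed.

Lemma continuous_add F G : continuous F -> continuous G -> continuous (fun x => F x + G x).
Proof. by move=> cF cG x; exact: (cvgD (cF x) (cG x)). Qed.

Lemma continuous_mul F G : continuous F -> continuous G -> continuous (fun x => F x * G x).
Proof. by move=> cF cG x; exact: (cvgM (cF x) (cG x)). Qed.

Lemma continuous_opp F : continuous F -> continuous (fun x => - F x).
Proof. by move=> cF x; exact: (cvgN (cF x)). Qed.

Lemma continuous_sqr F : continuous F -> continuous (fun x => F x ^+ 2).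
Proof. by move=> cF; exact: continuous_mul. Qed.

Lemma continuous_bigsum (I : Type) (s : seq I) (F : I -> 'rV[R]_n -> R) :
  (forall i, continuous (F i)) -> continuous (fun x => \sum_(i <- s) F i x).
Proof.
move=> cF; elim: s => [|i s IH].
  by rewrite (_ : (fun x => _) = cst 0); [exact: cst_continuous|apply/funext => x; rewrite big_nil].
rewrite (_ : (fun x => _) = (fun x => F i x + \sum_(i <- s) F i x)).
  exact: continuous_add.
by apply/funext => x; rewrite big_cons.
Qed.

Lemma ccont0 : ccont (fun _ : 'rV[R]_n => 0 : R).
Proof. by split; [exact: cst_continuous|exists 0]. Qed.

Lemma ccontD F G : ccont F -> ccont G -> ccont (fun x => F x + G x).
Proof.
move=> [cF [L hL]] [cG [M hM]]; split; first exact: continuous_add.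
by exists (Num.max L M) => x; rewrite ge_max => /andP[? ?]; rewrite hL// hM// addr0.
Qed.

Lemma ccontMl F G : continuous F -> ccont G -> ccont (fun x => F x * G x).
Proof.
move=> cF [cG [M hM]]; split; first exact: continuous_mul.
by exists M => x ?; rewrite hM// mulr0.
Qed.

Lemma ccontMr F G : ccont F -> continuous G -> ccont (fun x => F x * G x).
Proof.
move=> cF cG; rewrite (_ : (fun x => _) = (fun x => G x * F x)); first exact: ccontMl.
by apply/funext => x; rewrite mulrC.
Qed.

Lemma ccontZ a F : ccont F -> ccont (fun x => a * F x).
Proof. by apply: ccontMl; exact: cst_continuous. Qed.

Lemma ccont_sqr F : ccont F -> ccont (fun x => F x ^+ 2).
Proof. by move=> h; apply: ccontMr => //; case: h. Qed.

Lemma ccont_sum (I : Type) (s : seq I) (F : I -> 'rV[R]_n -> R) :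
  (forall i, ccont (F i)) -> ccont (fun x => \sum_(i <- s) F i x).
Proof.
move=> cF; elim: s => [|i s IH].
  by rewrite (_ : (fun x => _) = fun=> 0); [exact: ccont0|apply/funext => x; rewrite big_nil].
rewrite (_ : (fun x => _) = (fun x => F i x + \sum_(i <- s) F i x)).
  exact: ccontD.
by apply/funext => x; rewrite big_cons.
Qed.

Lemma Rn_int0 : Rn_int (fun _ : 'rV[R]_n => 0) = 0.
Proof. by have := Rn_intZ 0 ccont0; rewrite !mul0r. Qed.

Lemma Rn_int_sum (I : Type) (s : seq I) (F : I -> 'rV[R]_n -> R) :
  (forall i, ccont (F i)) -> Rn_int (fun x => \sum_(i <- s) F i x) = \sum_(i <- s) Rn_int (F i).
Proof.
move=> cF; elim: s => [|i s IH].
  by rewrite big_nil -[RHS]Rn_int0; apply: eq_Rn_int => x; rewrite big_nil.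
rewrite big_cons -IH -Rn_intD//; last exact: ccont_sum.
by apply: eq_Rn_int => x; rewrite big_cons.
Qed.

(** Where F is positive it exceeds a constant on a cube, which has positive
measure. *)
Lemma Rn_int_eq0 F : ccont F -> (forall x, 0 <= F x) -> Rn_int F <= 0 -> forall x, F x = 0.
Proof.
move=> ccF F0 I0 x; apply/eqP; rewrite eq_le F0 andbT leNgt; apply/negP => Fx.
have [cF _] := ccF.
pose e := F x / 2; have e0 : 0 < e by rewrite divr_gt0.
have /cvg_ballP/(_ _ e0) := cF x; move=> /nbhs_ballP[d /= d0 hd].
pose r := d / 2; have r0 : 0 < r by rewrite divr_gt0.
pose c i := x 0 i.
have : Rn_int F >= e * (2 * r) ^+ n.
  rewrite /Rn_int -[_ ^+ n]/(fine ((2 * r) ^+ n)%:E) -(lebesgue_cube c r0).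
  rewrite -(Rintegral_cst _ (measurable_cube c r)) Rintegral_mkcond.
  apply: (le_Rintegral measurableT (cst_cube_integrable c e r0) (ccont_integrable ccF)).
  move=> t _; rewrite patchE; case: ifPn => [|_]; last exact: F0.
  rewrite inE => bt /=.
  have : ball x d (row_of_tuple t).
    split => // i j; rewrite /ball /= !mxE ord1 distrC; apply: le_lt_trans (bt j) _.
    by rewrite /r ltr_pdivrMr// ltr_pMr// ltr1n.
  by move=> /hd; rewrite /= /ball /= /e ltr_distl => /andP[_]; lra.
move=> /le_trans/(_ I0); rewrite leNgt => /negP; apply.
by rewrite mulr_gt0// exprn_gt0// mulr_gt0.
Qed.

End lin.
End cc.

(** * Directional derivatives and integration by parts *)

Section line.
Context {R : realType}.

(** A directional derivative depends only on the restriction to a line. This is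
how derivatives are transported through translations, slices, concatenation of
coordinates and compositions. *)
Lemma is_derive_line (V W : normedModType R) (f : V -> R) (g : W -> R) x v y w d :
  (forall h : R, g (h *: w + y) = f (h *: v + x)) ->
  is_derive x v f d -> is_derive y w g d.
Proof.
move=> gf [df <-].
have gfx : g y = f x by have := gf 0; rewrite !scale0r !add0r.
have E : (fun h : R => h^-1 *: ((g \o shift y) (h *: w) - g y)) =
    (fun h => h^-1 *: ((f \o shift x) (h *: v) - f x)).
  by apply/funext => h /=; rewrite gf gfx.
by split; rewrite /derivable /derive E.
Qed.

Lemma continuous_lip m n (g : 'rV[R]_m -> 'rV[R]_n) :
  (forall (x : 'rV[R]_m) (e : R), 0 < e -> exists2 d : R, 0 < d &
     forall y : 'rV[R]_m, (forall i, `|x 0 i - y 0 i| < d) ->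
     forall j, `|g x 0 j - g y 0 j| < e) -> continuous g.
Proof.
move=> H x A /(nbhs_ballP (g x)) [e e0 es]; have [d d0 hd] := H x e e0.
apply/nbhs_ballP; exists d => //= y [_ bxy]; apply: es; split => // i j; rewrite ord1.
by apply: hd => k; have := bxy 0 k.
Qed.

Definition e_ n (i : 'I_n) : 'rV[R]_n := delta_mx 0 i.

Lemma e_coord n (i j : 'I_n) (t : R) (x : 'rV[R]_n) :
  (t *: e_ i + x) 0 j = t * (j == i)%:R + x 0 j.
Proof. by rewrite !mxE. Qed.

End line.

Section ibp.
Context {R : realType}.
Notation mR := (measurableTypeR R).
Notation leb := (@lebesgue_measure R).

(** The analogue of [tuple_cons] on row vectors, used to peel off one coordinate. *)
Definition vcons n (a : R) (y : 'rV[R]_n) : 'rV[R]_n.+1 :=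
  \row_i (if unlift ord0 i is Some j then y 0 j else a).

Lemma vcons0 n a (y : 'rV[R]_n) : vcons a y 0 ord0 = a.
Proof. by rewrite mxE unlift_none. Qed.

Lemma vconsS n a (y : 'rV[R]_n) j : vcons a y 0 (lift ord0 j) = y 0 j.
Proof. by rewrite mxE liftK. Qed.

Lemma row_of_tuple_cons n a (y : n.-tuple mR) : row_of_tuple (tuple_cons (a, y)) = vcons a (row_of_tuple y).
Proof.
apply/rowP => i; rewrite mxE; case: (unliftP ord0 i) => [j ->|->].
  by rewrite vconsS tnthS mxE.
by rewrite vcons0.
Qed.

Lemma sqnorm_vcons n a (y : 'rV[R]_n) : sqnorm (vcons a y) = a ^+ 2 + sqnorm y.
Proof.
rewrite /sqnorm big_ord_recl vcons0; congr (_ + _); apply: eq_bigr => i _.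
by rewrite vconsS.
Qed.

Lemma vcons_shift0 n a h (y : 'rV[R]_n) :
  vcons (h + a) y = h *: e_ ord0 + vcons a y.
Proof.
apply/rowP => i; rewrite e_coord.
case: (unliftP ord0 i) => [j ->|->].
  by rewrite !vconsS mulr0 add0r.
by rewrite !vcons0 eqxx mulr1.
Qed.

Lemma vcons_shiftS n a h j (y : 'rV[R]_n) :
  vcons a (h *: e_ j + y) = h *: e_ (lift ord0 j) + vcons a y.
Proof.
apply/rowP => i; rewrite e_coord.
case: (unliftP ord0 i) => [k ->|->].
  by rewrite !vconsS e_coord (inj_eq (@lift_inj _ ord0)).
by rewrite !vcons0 mulr0 add0r.
Qed.

Lemma continuous_vcons n (a : R) : continuous (@vcons n a).
Proof.
apply: continuous_lip => x e e0; exists e => // y hxy j.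
case: (unliftP ord0 j) => [k ->|->]; first by rewrite !vconsS.
by rewrite !vcons0 subrr normr0.
Qed.

Lemma continuous_vconsl n (y : 'rV[R]_n) : continuous (fun a : R => vcons a y).
Proof.
move=> a A /(nbhs_ballP (vcons a y)) [e e0 es]; apply/nbhs_ballP; exists e => //= b bab.
apply: es; split => // i j; rewrite ord1; case: (unliftP ord0 j) => [k ->|->].
  by rewrite !vconsS; exact: ballxx.
by rewrite !vcons0.
Qed.

Lemma integral_derive_compact (F f : R -> R) (r : R) :
  0 < r -> continuous f -> (forall x : R, is_derive x 1 F (f x)) ->
  (forall x : R, r <= `|x| -> F x = 0 /\ f x = 0) ->
  (\int[leb]_x (f x)%:E = 0)%E.
Proof.
move=> r0 cf dF h0.
have cF : continuous F.
  move=> x; apply: differentiable_continuous; apply/derivable1_diffP.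
  by have := dF x; case.
have rr : - r < r by rewrite gtrN.
transitivity (\int[leb]_(x in `[(- r)%R, r]) (f x)%:E)%E.
  rewrite [RHS]integral_mkcond; apply: eq_integral => x _; rewrite patchE.
  case: ifPn => // ; rewrite notin_setE /= in_itv /= -ler_norml => /negP.
  by rewrite -ltNge => /ltW /h0 [_ ->].
rewrite (@continuous_FTC2 _ f F) //.
- have [-> _] : F r = 0 /\ f r = 0 by apply: h0; rewrite gtr0_norm.
  have [-> _] : F (- r) = 0 /\ f (- r) = 0 by apply: h0; rewrite normrN gtr0_norm.
  by rewrite subee.
- exact: continuous_subspaceT.
- split.
  + by move=> x _; have := dF x; case.
  + exact: (cvg_at_right_filter (cF _)).
  + exact: (cvg_at_left_filter (cF _)).
- by move=> x _; rewrite derive1E; have := dF x; case.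
Qed.

(** Integration by parts in its simplest form. By induction on the dimension: the
differentiated coordinate is either the first one, integrated first thanks to
Fubini and killed by the fundamental theorem of calculus, or one of the others,
killed by the induction hypothesis. *)
Lemma Rn_int_derive n (i : 'I_n) (X Y : 'rV[R]_n -> R) : ccont X -> ccont Y ->
  (forall x, is_derive x (e_ i) X (Y x)) -> Rn_int Y = 0.
Proof.
elim: n i X Y => [|n IH] i X Y; first by case: i.
move=> ccX ccY dXY; have [cX [L hL]] := ccX; have [cY [M hM]] := ccY.
have [E1 E2] := fubini_cons (ccont_integrable ccY).
have [j def_i|def_i] := unliftP ord0 i.
  rewrite /Rn_int /Rintegral [X in fine X]E1 /= integral0_eq// => x _.
  under eq_integral do rewrite row_of_tuple_cons.
  have ccx (Z : 'rV[R]_n.+1 -> R) : ccont Z -> ccont (fun y => Z (vcons x y)).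
    move=> [cZ [K hK]]; split.
      by move=> y; apply: continuous_comp; [exact: continuous_vcons|exact: cZ].
    by exists K => y Ky; apply: hK; rewrite sqnorm_vcons ler_wpDl// sqr_ge0.
  have IHx : Rn_int (fun y => Y (vcons x y)) = 0.
    apply: (IH j (fun y => X (vcons x y))); [exact: ccx|exact: ccx|].
    move=> y; apply: is_derive_line (dXY (vcons x y)) => h.
    by rewrite vcons_shiftS def_i.
  rewrite -[LHS]fineK; first by congr (_%:E); exact: IHx.
  by apply: integrable_fin_num => //; exact: ccont_integrable (ccx _ ccY).
rewrite /Rn_int /Rintegral [X in fine X]E2 /= integral0_eq// => y _.
under eq_integral do rewrite row_of_tuple_cons.
have [r r0 hr] := sqr_bound (Num.max L M).
apply: (@integral_derive_compact (fun x => X (vcons x (row_of_tuple y))) _ r) => //.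
- by move=> x; apply: continuous_comp; [exact: continuous_vconsl|exact: cY].
- move=> x; apply: is_derive_line (dXY (vcons x (row_of_tuple y))) => h.
  by rewrite def_i -vcons_shift0 [_%:A]mulr1.
- move=> x rx; have : Num.max L M <= sqnorm (vcons x (row_of_tuple y)).
    apply: (le_trans hr); rewrite sqnorm_vcons ler_wpDr ?sqnorm_ge0//.
    by rewrite -(real_normK (num_real x)) ler_pXn2r// nnegrE// ltW.
  by rewrite ge_max => /andP[/hL -> /hM ->].
Qed.

Lemma Rn_int_cvg n (F_ : nat -> 'rV[R]_n -> R) (F : 'rV[R]_n -> R) (L M : R) :
  (forall m, continuous (F_ m)) -> continuous F ->
  (forall m x, L <= sqnorm x -> F_ m x = 0) ->
  (forall m x, `|F_ m x| <= M) ->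
  (forall x, F_ m x @[m --> \oo] --> F x) ->
  Rn_int (F_ m) @[m --> \oo] --> Rn_int F.
Proof.
move=> cF_ cF hL hM cv.
have [r r0 Lr] := sqr_bound L.
have hr m (t : n.-tuple mR) : ~ cube (fun=> 0) r t -> F_ m (row_of_tuple t) = 0.
  move=> nbt; apply: hL; apply: (le_trans Lr); rewrite leNgt; apply/negP => h; apply: nbt => i.
  by have := coord_le i (ltW r0) (ltW h); rewrite mxE subr0.
have := @dominated_convergence _ _ R (lebesgue_tuple R n) setT measurableT
  (fun m t => (F_ m (row_of_tuple t))%:E) (fun t => (F (row_of_tuple t))%:E)
  (EFin \o (cst M \_ (cube (fun=> 0) r))).
case.
- by move=> m; apply/measurable_EFinP; exact: measurable_row_of_tuple.
- by apply/measurable_EFinP; exact: measurable_row_of_tuple.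
- by apply: aeW => t _; apply: cvg_EFin; [exact: nearW|exact: cv].
- exact: cst_cube_integrable.
- apply: aeW => t m _ /=; rewrite lee_fin patchE; case: ifPn => [_|]; first exact: hM.
  by rewrite notin_setE => /hr ->; rewrite normr0.
move=> iF _ cvI; apply: fine_cvg.
rewrite fineK//; exact: integrable_fin_num.
Qed.

End ibp.

(** * Mass of a weight in Euclidean balls *)

Section mass.
Context {R : realType}.
Notation mR := (measurableTypeR R).
Notation leb := (@lebesgue_measure R).

Definition tuple_left d s (t : (d + s).-tuple mR) : d.-tuple mR :=
  [tuple tnth t (lshift s i) | i < d].
Definition tuple_right d s (t : (d + s).-tuple mR) : s.-tuple mR :=
  [tuple tnth t (rshift d i) | i < s].

Lemma measurable_tuple_left d s : measurable_fun [set: (d + s).-tuple mR] (@tuple_left d s).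
Proof.
apply/measurable_fun_tnthP => i.
rewrite (_ : _ \o _ = (@tnth (d + s) mR ^~ (lshift s i))); first exact: measurable_tnth.
by apply/funext => t /=; rewrite tnth_mktuple.
Qed.

Lemma measurable_tuple_right d s : measurable_fun [set: (d + s).-tuple mR] (@tuple_right d s).
Proof.
apply/measurable_fun_tnthP => i.
rewrite (_ : _ \o _ = (@tnth (d + s) mR ^~ (rshift d i))); first exact: measurable_tnth.
by apply/funext => t /=; rewrite tnth_mktuple.
Qed.

Lemma tuple_left_cons d s x (y : (d + s).-tuple mR) :
  @tuple_left d.+1 s (tuple_cons (x, y)) = tuple_cons (x, tuple_left y).
Proof.
apply: eq_from_tnth => i; rewrite tnth_mktuple.
case: (unliftP ord0 i) => [j ->|->].
  rewrite tnthS tnth_mktuple (_ : lshift s (lift ord0 j) = lift ord0 (lshift s j)).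
    by rewrite tnthS.
  exact: val_inj.
by rewrite (_ : lshift s ord0 = ord0 :> 'I_(d.+1 + s))//; exact: val_inj.
Qed.

Lemma tuple_right_cons d s x (y : (d + s).-tuple mR) :
  @tuple_right d.+1 s (tuple_cons (x, y)) = tuple_right y.
Proof.
apply: eq_from_tnth => i; rewrite !tnth_mktuple.
rewrite (_ : rshift d.+1 i = lift ord0 (rshift d i)); last exact: val_inj.
by rewrite tnthS.
Qed.

(** The measures are built one coordinate at a time from the left, so the
splitting into two blocks is proved by peeling the left block. *)
Lemma integral_prod_tuple d s (H : d.-tuple mR -> \bar R) (K : s.-tuple mR -> \bar R) :
  measurable_fun [set: d.-tuple mR] H -> measurable_fun [set: s.-tuple mR] K ->
  (forall t, 0 <= H t)%E -> (forall t, 0 <= K t)%E ->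
  (\int[lebesgue_tuple R (d + s)]_t (H (tuple_left t) * K (tuple_right t)) =
   \int[lebesgue_tuple R d]_t H t * \int[lebesgue_tuple R s]_t K t)%E.
Proof.
move=> mH mK H0 K0; elim: d H mH H0 => [|d IH] H mH H0.
  rewrite /= integral_dirac// diracT mul1e.
  rewrite -[RHS]ge0_integralZl//.
  apply: eq_integral => t _; congr (H _ * K _)%E; first exact: tuple0.
  by apply: eq_from_tnth => i; rewrite tnth_mktuple; congr tnth; exact: val_inj.
have mG : measurable_fun [set: (d + s).+1.-tuple mR] (fun t =>
    H (@tuple_left d.+1 s t) * K (@tuple_right d.+1 s t))%E.
  apply: emeasurable_funM.
  - exact: (measurableT_comp mH (@measurable_tuple_left d.+1 s)).
  - exact: (measurableT_comp mK (@measurable_tuple_right d.+1 s)).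
have mHc : measurable_fun [set: mR * d.-tuple mR] (H \o @tuple_cons R d).
  exact: (measurableT_comp mH (@measurable_tuple_cons R d)).
rewrite [LHS](tonelli_cons mG); last by move=> t; exact: mule_ge0.
rewrite (tonelli_cons mH)// -ge0_integralZr//.
- apply: eq_integral => x _; rewrite -IH//.
    by apply: eq_integral => y _; rewrite tuple_left_cons tuple_right_cons.
  exact: (measurable_fun_pair2 x mHc).
- exact: (measurable_fun_fubini_tonelli_F _ mHc (fun=> H0 _)).
- by move=> x _; apply: integral_ge0.
- exact: integral_ge0.
Qed.

(** The mass of W in the ball of radius r, tested from below by compactly
supported functions: this keeps indicator functions and extended reals out of
the energy estimates. *)
Definition mass_le n (W : 'rV[R]_n -> R) (r m : R) : Prop :=
  forall F, ccont F -> (forall x, 0 <= F x <= W x) -> (forall x, r ^+ 2 <= sqnorm x -> F x = 0) ->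
  Rn_int F <= m.

Lemma sqnorm_split d s (x : 'rV[R]_(d + s)) : sqnorm x = sqnorm (lsubmx x) + sqnorm (rsubmx x).
Proof.
rewrite /sqnorm big_split_ord /=; congr (_ + _); apply: eq_bigr => i _; by rewrite mxE.
Qed.

Lemma continuous_sqnorm n : continuous (@sqnorm R n).
Proof.
apply: continuous_bigsum => i; apply: continuous_sqr; exact: coord_continuous.
Qed.

Lemma ball_measurable n r : measurable [set t : n.-tuple mR | \sum_(i < n) tnth t i ^+ 2 < r].
Proof.
have := @measurable_row_of_tuple R n _ (@continuous_sqnorm n).
move=> /(_ measurableT [set` `]-oo, r[]) => /(_ (measurable_itv _)).
rewrite setTI; congr measurable; apply/seteqP; split => t /=; rewrite in_itv /=;
 by congr (_ < _); apply: eq_bigr => i _; rewrite mxE.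
Qed.

(** A ball of radius r lies in the product of the ball of R^d with a cube of side
2r, so freezing the last s variables costs a factor (2r)^s. *)
Lemma mass_le_ball d s (gamma : 'rV[R]_d -> R) (r M : R) : 0 < r ->
  continuous gamma -> (forall x, 0 <= gamma x) ->
  (ball_integral gamma r <= M%:E)%E ->
  mass_le (fun x : 'rV[R]_(d + s) => gamma (lsubmx x)) r ((2 * r) ^+ s * M).
Proof.
move=> r0 cg g0 hM F cF FW FQ.
pose D := [set t : d.-tuple mR | \sum_(i < d) tnth t i ^+ 2 < r ^+ 2].
have mD : measurable D by exact: ball_measurable.
pose H := (fun t : d.-tuple mR => (gamma (row_of_tuple t))%:E) \_ D.
pose B := cube (fun _ : 'I_s => 0 : R) r.
have mB : measurable B by exact: measurable_cube.
have mH : measurable_fun setT H.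
  apply/(measurable_restrictT _ mD); apply: measurable_funTS.
  by apply/measurable_EFinP; exact: measurable_row_of_tuple.
have H0 t : (0 <= H t)%E.
  by rewrite /H patchE; case: ifPn => // _; rewrite lee_fin.
have iH : (\int[lebesgue_tuple R d]_t H t <= M%:E)%E.
  by rewrite -integral_mkcond.
have E := @integral_prod_tuple d s H (EFin \o \1_B) mH _ H0 _.
have mK : measurable_fun [set: s.-tuple mR] (EFin \o \1_B : _ -> \bar R).
  by apply/measurable_EFinP; exact: measurable_indic.
have K0 t : (0 <= (EFin \o \1_B) t :> \bar R)%E by rewrite /= lee_fin.
have {}E := E mK K0.
have IB : (\int[lebesgue_tuple R s]_t ((EFin \o \1_B) t : \bar R) = ((2 * r) ^+ s)%:E)%E.
  by rewrite integral_indic// setIT; exact: lebesgue_cube.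
rewrite -lee_fin EFinM muleC.
apply: (@le_trans _ _ (\int[lebesgue_tuple R (d + s)]_t
    (H (tuple_left t) * (EFin \o \1_B) (tuple_right t)))%E); last first.
  rewrite E IB; apply: lee_wpmul2r => //.
  by rewrite lee_fin exprn_ge0// mulr_ge0// ltW.
rewrite /Rn_int /Rintegral fineK; last by apply: integrable_fin_num => //; exact: ccont_integrable.
apply: ge0_le_integral => //.
- by move=> t _; rewrite lee_fin; have /andP[] := FW (row_of_tuple t).
- by apply/measurable_EFinP; apply: measurable_row_of_tuple; case: cF.
- apply: emeasurable_funM.
  + exact: (measurableT_comp mH (@measurable_tuple_left d s)).
  + exact: (measurableT_comp mK (@measurable_tuple_right d s)).
move=> t _; have /andP[F0 F1] := FW (row_of_tuple t).
have [h|h] := leP (r ^+ 2) (sqnorm (row_of_tuple t)).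
  by rewrite FQ// mule_ge0.
have lE : lsubmx (row_of_tuple t) = row_of_tuple (tuple_left t).
  by apply/rowP => i; rewrite !mxE tnth_mktuple.
have rE : rsubmx (row_of_tuple t) = row_of_tuple (tuple_right t).
  by apply/rowP => i; rewrite !mxE tnth_mktuple.
move: h; rewrite sqnorm_split lE rE => h.
have QE n (z : n.-tuple mR) : sqnorm (row_of_tuple z) = \sum_(i < n) tnth z i ^+ 2.
  by apply: eq_bigr => i _; rewrite mxE.
rewrite /H patchE mem_set; last first.
  by rewrite /D /= -QE; apply: le_lt_trans h; rewrite lerDl sqnorm_ge0.
rewrite /= indicE mem_set; last first.
  move=> i; rewrite subr0; have := @coord_le R s (row_of_tuple (tuple_right t)) i r.
  rewrite mxE; apply; first exact: ltW.
  by apply: ltW; apply: le_lt_trans h; rewrite lerDr sqnorm_ge0.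
by rewrite mule1 lee_fin -lE.
Qed.

Lemma ball_integral_ge d (gamma F : 'rV[R]_d -> R) (r : R) :
  continuous gamma -> (forall x, 0 <= gamma x) ->
  ccont F -> (forall x, 0 <= F x <= gamma x) -> (forall x, r ^+ 2 <= sqnorm x -> F x = 0) ->
  ((Rn_int F)%:E <= ball_integral gamma r)%E.
Proof.
move=> cg g0 cF FW FQ.
have mD : measurable [set t : d.-tuple mR | \sum_(i < d) tnth t i ^+ 2 < r ^+ 2].
  exact: ball_measurable.
rewrite /Rn_int /Rintegral fineK; last by apply: integrable_fin_num => //; exact: ccont_integrable.
rewrite /ball_integral [leRHS]integral_mkcond; apply: ge0_le_integral => //.
- by move=> t _; rewrite lee_fin; have /andP[] := FW (row_of_tuple t).
- by apply/measurable_EFinP; apply: measurable_row_of_tuple; case: cF.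
- apply/(measurable_restrictT _ mD); apply: measurable_funTS.
  by apply/measurable_EFinP; exact: measurable_row_of_tuple.
move=> t _; rewrite patchE; case: ifPn => [_|].
  by rewrite lee_fin; have /andP[] := FW (row_of_tuple t).
rewrite notin_setE /= => /negP; rewrite -leNgt => h.
rewrite FQ//; apply: (le_trans h); rewrite le_eqVlt; apply/orP; left; apply/eqP.
by apply: eq_bigr => i _; rewrite mxE.
Qed.

End mass.

(** * Divergence of the dyadic series of the growth class *)

Section dyadic.
Context {R : realType}.
Notation leb := (@lebesgue_measure R).

(** The integral of a nonnegative function is a supremum over simple functions
below it, hence monotone even for functions that are not known to be measurable,
such as the integrand 1/(r g(r)) of the growth class. *)
Lemma ge0_le_integral_nonmeas d (T : measurableType d) (mu : {measure set T -> \bar R})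
    (D : set T) (f1 f2 : T -> \bar R) :
  (forall x, D x -> 0 <= f1 x)%E -> (forall x, D x -> f1 x <= f2 x)%E ->
  (\int[mu]_(x in D) f1 x <= \int[mu]_(x in D) f2 x)%E.
Proof.
move=> f10 f12; rewrite !(integral_mkcond D).
have h10 x : (0 <= (f1 \_ D) x)%E by apply: erestrict_ge0.
have h20 x : (0 <= (f2 \_ D) x)%E.
  by apply: erestrict_ge0 => // t /[dup] Dt /f12; apply: le_trans; exact: f10.
have h12 x : ((f1 \_ D) x <= (f2 \_ D) x)%E by apply: lee_restrict.
rewrite !ge0_integralTE//; apply: le_ereal_sup => _ [h hle <-].
by exists h => // x; exact: le_trans (hle x) (h12 x).
Qed.

(** On a dyadic interval [2^k, 2^(k+1)) the integrand is at most
1/(2^k g(2^k)), so the series of the 1/g(2^k) dominates the integral. Near 1 the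
integral could diverge for a reason unrelated to the growth of g; the lower
bound c excludes this. *)
Lemma class_G_series (g : R -> R) (c : R) : class_G g -> 0 < c ->
  (forall r, 1 < r -> c <= g r) ->
  forall A, exists N, A <= \sum_(k < N) (g (2 ^+ k.+1))^-1.
Proof.
move=> [g0 gm gI] c0 gc A; apply/not_existsP => hN.
pose I k : set (measurableTypeR R) := [set` `[2 ^+ k, 2 ^+ k.+1[].
(* At the point 1 itself g is not bounded below by c. *)
pose b0 := Num.max c^-1 (g 1)^-1.
pose b k : R := if k is k'.+1 then (2 ^+ k * g (2 ^+ k))^-1 else b0.
have two_gt0 k : 0 < 2 ^+ k :> R by rewrite exprn_gt0.
have two_gt1 k : 1 < 2 ^+ k.+1 :> R by rewrite exprn_egt1// ltr1n.
have gpos r : 1 < r -> 0 < g r by move=> /gc; exact: lt_le_trans.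
have b0_ge0 : 0 <= b0 by rewrite le_max invr_ge0 ltW.
have b_ge0 k : 0 <= b k.
  by case: k => [//|k]; rewrite invr_ge0 mulr_ge0// ltW// gpos.
have I_meas k : measurable (I k) by exact: measurable_itv.
have Ib k : (\int[leb]_x (b k * \1_(I k) x)%:E = (b k * 2 ^+ k)%:E)%E.
  under eq_integral do rewrite EFinM.
  have I0 x : [set: R] x -> (0 <= (\1_(I k) x)%:E :> \bar R)%E.
    by move=> _; rewrite lee_fin indicE ler0n.
  have mI : measurable_fun [set: measurableTypeR R] (fun x => (\1_(I k) x)%:E : \bar R).
    by apply/measurable_EFinP; exact: (measurable_indic (I_meas k)).
  rewrite (ge0_integralZl_EFin leb measurableT I0 mI (b_ge0 k)).
  have IE : (\int[leb]_x (\1_(I k) x)%:E = (2 ^+ k)%:E)%E.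
    rewrite integral_indic ?setIT// -[LHS]/(leb [set` `[(2 ^+ k)%R, (2 ^+ k.+1)%R[]).
    rewrite lebesgue_measure_itv /= lte_fin ltr_eXn2l ?ltr1n// ltnSn -EFinD exprS.
    by congr (_%:E); ring.
  by rewrite IE EFinM.
suff : (+oo <= (b0 + A)%:E)%E by rewrite leye_eq.
rewrite -gI.
apply: (@le_trans _ _ (\int[leb]_x (\sum_(0 <= k <oo) (b k * \1_(I k) x)%:E))%E).
  rewrite integral_mkcond; apply: ge0_le_integral_nonmeas => x _; rewrite patchE; case: ifPn => // xin.
  - rewrite lee_fin invr_ge0; move: xin; rewrite inE /= in_itv /= andbT => x1.
    have x0 : 0 < x by exact: lt_le_trans x1.
    by apply: mulr_ge0; [exact: ltW|exact: g0].
  - move: xin; rewrite inE /= in_itv /= andbT => x1.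
    have x0 : 0 < x by exact: lt_le_trans x1.
    have [k xk] : exists k, I k x.
      pose n := Num.truncn x.
      have /andP[n1 n2] := Num.Theory.truncn_itv (ltW x0).
      have n0 : (0 < n)%N by rewrite lt0n; apply/negP => /eqP nz; move: n2; rewrite -/n nz ltNge x1.
      exists (trunc_log 2 n); have /andP[l1 l2] := @trunc_log_bounds 2 n isT n0.
      rewrite /I /= in_itv /=; apply/andP; split.
        by apply: le_trans n1; rewrite -natrX ler_nat.
      by apply: lt_le_trans n2 _; rewrite -natrX ler_nat.
    apply: (@le_trans _ _ (b k * \1_(I k) x)%:E); last first.
      have le_part : (\sum_(0 <= j < k.+1) (b j * \1_(I j) x)%:E <=
          \sum_(0 <= j <oo) (b j * \1_(I j) x)%:E)%E.
        by apply: nneseries_lim_ge => j _ _; rewrite lee_fin mulr_ge0.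
      apply: le_trans le_part; rewrite big_nat_recr//= leeDr// sume_ge0// => j _.
      by rewrite lee_fin mulr_ge0.
    rewrite lee_fin indicE mem_set// mulr1.
    move: xk; rewrite /I /= in_itv /= => /andP[xk1 xk2].
    case: k xk1 xk2 => [|k] xk1 xk2.
      rewrite /b /b0 le_max; move: x1; rewrite le_eqVlt => /orP[/eqP <-|x1].
        by rewrite mul1r lexx orbT.
      apply/orP; left; rewrite lef_pV2 ?posrE ?mulr_gt0 ?gpos//.
      by rewrite -[leLHS]mul1r ler_pM ?(ltW c0) ?gc// ltW.
    have p1 : 0 < 2 ^+ k.+1 * g (2 ^+ k.+1) by rewrite mulr_gt0// gpos.
    have gx : g (2 ^+ k.+1) <= g x by exact: gm.
    have xg : 2 ^+ k.+1 * g (2 ^+ k.+1) <= x * g x.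
      by apply: ler_pM => //; apply: ltW => //; exact: gpos.
    by rewrite /b lef_pV2 ?posrE//; exact: lt_le_trans xg.
  - by apply: nneseries_ge0 => k _ _; rewrite lee_fin mulr_ge0.
rewrite integral_nneseries//; last 2 first.
- by move=> k; apply/measurable_EFinP; apply: measurable_funM => //; exact: (measurable_indic (I_meas k)).
- by move=> k x _; rewrite lee_fin mulr_ge0.
apply: lime_le; first by apply: is_cvg_nneseries => k _ _; rewrite Ib lee_fin mulr_ge0// ltW.
apply: nearW => n; under eq_bigr do rewrite Ib.
rewrite sumEFin lee_fin; case: n => [|n].
  rewrite big_nil addr_ge0//; have /negP := hN 0%N.
  by rewrite big_ord0 -ltNge => /ltW.
rewrite big_mkord big_ord_recl /= expr0 mulr1 lerD2l.
apply: ltW; have /negP := hN n; rewrite -ltNge; apply: le_lt_trans.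
apply: ler_sum => i _; rewrite invfM mulrAC mulVf ?mul1r// gt_eqF//.
Qed.

End dyadic.

(** * Functions with continuous gradient *)

Section C1.
Context {R : realType}.

(** The gradient is a parameter: derivatives of products and quotients then come
with explicit formulas on which the field tactics work. *)
Definition C1 n (F : 'rV[R]_n -> R) (dF : 'I_n -> 'rV[R]_n -> R) : Prop :=
  [/\ continuous F, forall i x, is_derive x (e_ i) F (dF i x) & forall i, continuous (dF i)].

Lemma is_derive_comp (V : normedModType R) (F : V -> R) (P : R -> R) x v d p :
  is_derive x v F d -> is_derive (F x) 1 P p -> is_derive x v (fun y => P (F y)) (p * d).
Proof.
move=> dF dP; pose f (h : R) := F (h *: v + x).
have df : is_derive (0 : R) 1 f d.
  apply: (is_derive_line _ dF) => h.
  by rewrite /f addr0 [_%:A]mulr1.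
have f0 : f 0 = F x by rewrite /f scale0r add0r.
have dP0 : is_derive (f 0) 1 P p by rewrite f0.
have dPf : is_derive (0 : R) 1 (P \o f) (p * d).
  split; first by apply/derivable1_diffP; apply: differentiable_comp;
    apply/derivable1_diffP; [case: df|case: dP0].
  rewrite -derive1E derive1_comp; [|by case: df|by case: dP0].
  by rewrite !derive1E; case: df => _ ->; case: dP0 => _ ->.
apply: (is_derive_line _ dPf) => h.
by rewrite /= /f addr0 [_%:A]mulr1.
Qed.

Section n.
Variable n : nat.
Implicit Types (F G : 'rV[R]_n -> R) (dF dG : 'I_n -> 'rV[R]_n -> R).

Lemma C1_ext F dF G dG : C1 F dF -> (forall x, F x = G x) ->
  (forall i x, dF i x = dG i x) -> C1 G dG.
Proof.
move=> h FG dFG; have -> : G = F by apply/funext => x.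
by have -> : dG = dF by apply/funext => i; apply/funext => x.
Qed.

Lemma C1_cst (c : R) : @C1 n (fun=> c : R) (fun _ _ => 0).
Proof.
split=> [|i x|i]; [exact: cst_continuous|exact: is_derive_cst|exact: cst_continuous].
Qed.

Lemma C1D F dF G dG : C1 F dF -> C1 G dG ->
  C1 (fun x => F x + G x) (fun i x => dF i x + dG i x).
Proof.
move=> [cF DF cdF] [cG DG cdG]; split=> [|i x|i]; try exact: continuous_add.
have := DF i x; have := DG i x => ? ?; exact: is_deriveD.
Qed.

Lemma C1M F dF G dG : C1 F dF -> C1 G dG ->
  C1 (fun x => F x * G x) (fun i x => F x * dG i x + G x * dF i x).
Proof.
move=> [cF DF cdF] [cG DG cdG]; split=> [|i x|i].
- exact: continuous_mul.
- have := DF i x; have := DG i x => ? ?; exact: is_deriveM.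
- by apply: continuous_add; exact: continuous_mul.
Qed.

Lemma C1Z (c : R) F dF : C1 F dF -> C1 (fun x => c * F x) (fun i x => c * dF i x).
Proof.
move=> hF; apply: (C1_ext (C1M (C1_cst c) hF)) => // i x.
by rewrite mulr0 addr0.
Qed.

Lemma C1N F dF : C1 F dF -> C1 (fun x => - F x) (fun i x => - dF i x).
Proof.
by move=> hF; apply: (C1_ext (C1Z (-1) hF)) => [x|i x]; rewrite mulN1r.
Qed.

Lemma C1_sum (I : Type) (s : seq I) (F : I -> 'rV[R]_n -> R) (dF : I -> 'I_n -> 'rV[R]_n -> R) :
  (forall k, C1 (F k) (dF k)) ->
  C1 (fun x => \sum_(k <- s) F k x) (fun i x => \sum_(k <- s) dF k i x).
Proof.
move=> hF; elim: s => [|k s IH].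
  by apply: (C1_ext (C1_cst 0)) => [x|i x]; rewrite big_nil.
by apply: (C1_ext (C1D (hF k) IH)) => [x|i x]; rewrite big_cons.
Qed.

Lemma C1_comp F dF (P P' : R -> R) : C1 F dF ->
  (forall t : R, is_derive t 1 P (P' t)) -> continuous P' ->
  C1 (fun x => P (F x)) (fun i x => P' (F x) * dF i x).
Proof.
move=> [cF DF cdF] DP cP'.
have cP : continuous P.
  by move=> t; apply: differentiable_continuous; apply/derivable1_diffP; case: (DP t).
split=> [x|i x|i].
- by apply: continuous_comp; [exact: cF|exact: cP].
- exact: is_derive_comp (DF i x) (DP (F x)).
- apply: continuous_mul => // x.
  by apply: continuous_comp; [exact: cF|exact: cP'].
Qed.

Lemma continuous_inv F : continuous F -> (forall x, F x != 0) ->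
  continuous (fun x => (F x)^-1).
Proof. by move=> cF F0 x; exact: (cvgV (F0 x) (cF x)). Qed.

Lemma C1V F dF : C1 F dF -> (forall x, F x != 0) ->
  C1 (fun x => (F x)^-1) (fun i x => - (F x) ^- 2 * dF i x).
Proof.
move=> [cF DF cdF] F0; split=> [|i x|i].
- exact: continuous_inv.
- have [dv <-] := DF i x; split; [exact: derivableV|exact: deriveV].
- apply: continuous_mul => //; apply: continuous_opp; apply: continuous_inv.
    exact: continuous_sqr.
  by move=> x; rewrite expf_neq0.
Qed.

Lemma C1_sqnorm : C1 (@sqnorm R n) (fun i x => 2 * x 0 i).
Proof.
have hc (k : 'I_n) : C1 (fun x : 'rV[R]_n => x 0 k) (fun i _ => (k == i)%:R).
  split=> [|i x|i]; [exact: coord_continuous| |exact: cst_continuous].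
  have h : is_derive (x 0 k) (k == i)%:R (fun t : R => t) (k == i)%:R by exact: is_derive_id.
  apply: (is_derive_line _ h) => t /=.
  by rewrite e_coord.
apply: (C1_ext (C1_sum (index_enum 'I_n) (fun k => C1M (hc k) (hc k)))) => [x|i x].
  by [].
rewrite (bigD1 i)//= eqxx mulr1 -mulr2n mulr_natl big1 ?addr0// => k /negPf ->.
by rewrite mulr0 addr0.
Qed.

Lemma C1_class F : class_C 1 F -> C1 F (fun i => partial i F).
Proof.
move=> [cF h]; split=> // [i x|i]; last by have [_ []] := h i.
by have [d _] := h i; apply: derivableP; exact: d.
Qed.

Lemma C1_partial F dF i x : C1 F dF -> partial i F x = dF i x.
Proof. by move=> [_ D _]; rewrite /partial; case: (D i x). Qed.

(** Mean value theorem along a coordinate line, with the intermediate point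
located only through the size of its displacement. *)
Lemma mvt_line F (i : 'I_n) (dF : 'rV[R]_n -> R) x (h : R) :
  (forall y, is_derive y (e_ i) F (dF y)) ->
  exists2 t, `|t| <= `|h| & F (h *: e_ i + x) - F x = h * dF (t *: e_ i + x).
Proof.
move=> D; pose f (t : R) := F (t *: e_ i + x).
pose df (t : R) := dF (t *: e_ i + x).
have Df (t : R) : is_derive t 1 f (df t).
  apply: (is_derive_line _ (D (t *: e_ i + x))) => k.
  by rewrite /f [_%:A]mulr1 scalerDl addrA.
have cf : continuous f.
  by move=> t; apply: differentiable_continuous; apply/derivable1_diffP; case: (Df t).
have f0 : f 0 = F x by rewrite /f scale0r add0r.
have [h0|h0] := leP 0 h.
  have [t] := MVT_segment h0 (fun t _ => Df t) (continuous_subspaceT cf).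
  rewrite in_itv /= => /andP[t0 th]; rewrite f0 subr0 => E.
  by exists t; [rewrite !ger0_norm|rewrite mulrC -E].
have [t] := MVT_segment (ltW h0) (fun t _ => Df t) (continuous_subspaceT cf).
rewrite in_itv /= => /andP[t0 th]; rewrite f0 sub0r => E.
exists t; first by rewrite ler0_norm // ltr0_norm// lerN2.
by apply: oppr_inj; rewrite opprB E mulrN mulrC.
Qed.

Lemma e_coord_dist (i j : 'I_n) (t : R) x : `|(t *: e_ i + x) 0 j - x 0 j| <= `|t|.
Proof.
by rewrite e_coord addrK normrM; case: (j == i); rewrite ?normr1 ?normr0 ?mulr1 ?mulr0.
Qed.

(** Move from the origin to x one coordinate at a time. *)
Lemma C1_grad0 F dF : C1 F dF -> (forall i x, dF i x = 0) -> exists c, forall x, F x = c.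
Proof.
move=> [cF D _] h0; exists (F 0) => x.
pose y k : 'rV[R]_n := \row_i (if (i < k)%N then x 0 i else 0).
have yx : y n = x by apply/rowP => i; rewrite mxE ltn_ord.
have y0 : y 0%N = 0 by apply/rowP => i; rewrite !mxE.
suff H : forall k, (k <= n)%N -> F (y k) = F 0 by rewrite -yx H.
elim => [|k IH] kn; first by rewrite y0.
rewrite -(IH (ltnW kn)); pose i := Ordinal kn.
have -> : y k.+1 = x 0 i *: e_ i + y k.
  apply/rowP => j; rewrite e_coord !mxE ltnS leq_eqVlt -(inj_eq val_inj j i) /=.
  case: eqVneq => [jk|_] /=; last by rewrite mulr0 add0r.
  by rewrite jk ltnn addr0 mulr1; congr (x 0 _); exact: val_inj.
have [t _ E] := mvt_line (y k) (x 0 i) (D i).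
by apply/eqP; rewrite -subr_eq0 E h0 mulr0.
Qed.

End n.

End C1.

(** * Cutoff functions of small Dirichlet energy *)

Section step.
Context {R : realType}.
Implicit Types t : R.

Definition pospart t : R := Num.max t 0.

(** For the square of the positive part the remainder is quadratic also at 0, so
this criterion avoids one-sided limits. *)
Lemma is_derive_quad (F : R -> R) t d : (forall h, `|F (h + t) - F t - d * h| <= h ^+ 2) ->
  is_derive t 1 F d.
Proof.
move=> H.
have cv : h^-1 *: ((F \o shift t) (h *: 1) - F t) @[h --> 0^'] --> d.
  apply/cvgrPdist_le => e e0; near=> h.
  have h0 : h != 0 by near: h; exact: nbhs_dnbhs_neq.
  rewrite /= [_%:A]mulr1.
  have -> : d - h^-1 *: (F (h + t) - F t) = - (h^-1 * (F (h + t) - F t - d * h)).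
    by rewrite /GRing.scale /=; field.
  rewrite normrN normrM normfV ler_pdivrMl ?normr_gt0//.
  apply: le_trans (H h) _; rewrite -[_ ^+ 2]real_normK ?num_real// expr2.
  rewrite ler_wpM2l//; near: h.
  apply: dnbhs0_le; exact: e0.
split; first by apply/cvg_ex; exists d.
exact: cvg_lim cv.
Unshelve. all: by end_near.
Qed.

Lemma is_derive_sqr_pospart t : is_derive t 1 (fun t => pospart t ^+ 2) (2 * pospart t).
Proof.
apply: is_derive_quad => h; rewrite /pospart ler_norml.
by case: (leP (h + t) 0); case: (leP t 0) => ? ?; apply/andP; split; nra.
Qed.

Lemma continuous_pospart : continuous pospart.
Proof.
move=> t A /nbhs_ballP[e /= e0 es]; apply/nbhs_ballP; exists e => //= s.
rewrite /ball /= => ts; apply: es; rewrite /ball /=; apply: le_lt_trans ts.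
rewrite /pospart; case: (leP t 0); case: (leP s 0) => hs ht.
- by rewrite subrr normr0.
- by rewrite sub0r normrN ger0_norm ?(ltW hs)// distrC; apply: le_trans (ler_norm _); lra.
- by rewrite subr0 gtr0_norm//; apply: le_trans (ler_norm _); lra.
- by [].
Qed.

(** A piecewise quadratic spline descending from 1 to 0 on [1, 4], with knots
1, 5/2 and 4: the lightest C^1 step function. *)
Definition step t : R :=
  1 + (- 2 / 9 * pospart (t - 1) ^+ 2 + 4 / 9 * pospart (t - 5 / 2) ^+ 2 + - 2 / 9 * pospart (t - 4) ^+ 2).
Definition dstep t : R :=
  - 4 / 9 * pospart (t - 1) + 8 / 9 * pospart (t - 5 / 2) + - 4 / 9 * pospart (t - 4).

Lemma is_derive_step t : is_derive t 1 step (dstep t).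
Proof.
have D c : is_derive t 1 (fun t => pospart (t - c) ^+ 2) (2 * pospart (t - c)).
  by apply: (is_derive_line _ (is_derive_sqr_pospart (t - c))) => h; rewrite addrA.
have := D 1; have := D (5 / 2); have := D 4 => D1 D2 D3.
have -> : step = cst 1 + ((- 2 / 9) \*: (fun t => pospart (t - 1) ^+ 2) +
   (4 / 9) \*: (fun t => pospart (t - 5 / 2) ^+ 2) + (- 2 / 9) \*: (fun t => pospart (t - 4) ^+ 2)) by [].
have E := is_deriveD (is_derive_cst (1 : R) t 1) (is_deriveD (is_deriveD
  (is_deriveZ (- 2 / 9) D3) (is_deriveZ (4 / 9) D2)) (is_deriveZ (- 2 / 9) D1)).
apply: (is_derive_eq E); rewrite /dstep /GRing.scale /=; lra.
Qed.

Lemma continuous_dstep : continuous dstep.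
Proof.
have c a b : continuous (fun t : R => a * pospart (t - b)).
  have c1 : continuous (fun t : R => t - b) by move=> t; exact: (cvgB cvg_id (cvg_cst b)).
  by move=> t; exact: (cvgM (cvg_cst a) (cvg_comp _ _ (c1 t) (continuous_pospart (x := t - b)))).
by move=> t; exact: (cvgD (cvgD (c _ _ t) (c _ _ t)) (c _ _ t)).
Qed.

Ltac stepcases t := rewrite /step /dstep /pospart;
 case: (leP (t - 1) 0); case: (leP (t - 5 / 2) 0); case: (leP (t - 4) 0) => ? ? ?.

Lemma step1 t : t <= 1 -> step t = 1 /\ dstep t = 0.
Proof. by move=> h; stepcases t; split; nra. Qed.

Lemma step0 t : 4 <= t -> step t = 0 /\ dstep t = 0.
Proof. by move=> h; stepcases t; split; nra. Qed.

Lemma step_itv t : 0 <= step t <= 1.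
Proof. by stepcases t; apply/andP; split; nra. Qed.

Lemma dstep_bound t : dstep t ^+ 2 <= 1.
Proof.
have : - 1 <= dstep t <= 1 by stepcases t; apply/andP; split; nra.
by move=> /andP[? ?]; nra.
Qed.

End step.

Section cutoff.
Context {R : realType}.

(** rho bounds the squared norm. The gradient is asked to vanish where phi is
known to be 1, which includes the boundary of that ball. *)
Record is_cutoff n (rho : R) (phi : 'rV[R]_n -> R) (dphi : 'I_n -> 'rV[R]_n -> R) : Prop :=
  IsCutoff {
    cutoff_C1 : C1 phi dphi;
    cutoff_itv : forall x, 0 <= phi x <= 1;
    cutoff1 : forall x, sqnorm x <= rho -> phi x = 1 /\ forall i, dphi i x = 0;
    cutoff_supp : exists L, forall x, L <= sqnorm x -> phi x = 0 /\ forall i, dphi i x = 0 }.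

Lemma cutoff_ccont n rho phi dphi : @is_cutoff n rho phi dphi -> ccont phi.
Proof.
case=> [[c _ _] _ _ [L hL]]; split=> //; exists L => x Lx; by case: (hL x Lx).
Qed.

Lemma cutoff_grad_ccont n rho phi dphi : @is_cutoff n rho phi dphi -> forall i, ccont (dphi i).
Proof.
move=> [[_ _ c] _ _ [L hL]] i; split=> //; exists L => x Lx; by case: (hL x Lx) => _ ->.
Qed.

(** The transition takes place in the shell rho < |x|^2 < 4 rho, between radii r
and 2r for rho = r^2. *)
Definition bump n (rho : R) (x : 'rV[R]_n) : R := step (rho^-1 * sqnorm x).
Definition dbump n (rho : R) (i : 'I_n) (x : 'rV[R]_n) : R :=
  dstep (rho^-1 * sqnorm x) * (rho^-1 * (2 * x 0 i)).

Lemma bump_outside n rho (x : 'rV[R]_n) : 0 < rho -> 4 * rho <= sqnorm x ->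
  bump rho x = 0 /\ forall i, dbump rho i x = 0.
Proof.
move=> r0 h; have [] := @step0 R (rho^-1 * sqnorm x).
  by rewrite mulrC ler_pdivlMr.
by rewrite /bump /dbump => -> ->; split => // i; rewrite mul0r.
Qed.

Lemma bump_inside n rho (x : 'rV[R]_n) : 0 < rho -> sqnorm x <= rho ->
  bump rho x = 1 /\ forall i, dbump rho i x = 0.
Proof.
move=> r0 h; have [] := @step1 R (rho^-1 * sqnorm x).
  by rewrite mulrC ler_pdivrMr// mul1r.
by rewrite /bump /dbump => -> ->; split => // i; rewrite mul0r.
Qed.

Lemma bump_cutoff n rho : 0 < rho -> @is_cutoff n rho (bump rho) (dbump rho).
Proof.
move=> r0; split.
- apply: (C1_ext (C1_comp (C1Z rho^-1 (@C1_sqnorm R n)) (@is_derive_step R) (@continuous_dstep R))) => //.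
- by move=> x; exact: step_itv.
- by move=> x; exact: bump_inside.
- by exists (4 * rho) => x; exact: bump_outside.
Qed.

Lemma bump_grad n rho (x : 'rV[R]_n) : 0 < rho -> \sum_i dbump rho i x ^+ 2 <= 16 / rho.
Proof.
move=> r0; have [h|h] := leP (4 * rho) (sqnorm x).
  rewrite big1 ?divr_ge0 ?ltW// => i _; have [_ ->] := bump_outside r0 h; by rewrite expr0n.
rewrite /dbump; under eq_bigr do rewrite !exprMn.
rewrite -!mulr_sumr -/(sqnorm x).
apply: (@le_trans _ _ (1 * (rho^-1 ^+ 2 * (2 ^+ 2 * sqnorm x)))).
  apply: ler_wpM2r; last exact: dstep_bound.
  by apply: mulr_ge0; [exact: sqr_ge0|apply: mulr_ge0; [exact: sqr_ge0|exact: sqnorm_ge0]].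
rewrite mul1r; apply: (@le_trans _ _ (rho^-1 ^+ 2 * (2 ^+ 2 * (4 * rho)))).
  by rewrite !ler_wpM2l ?sqr_ge0// ltW.
by rewrite le_eqVlt; apply/orP; left; apply/eqP; field; rewrite gt_eqF.
Qed.

Lemma sqr_sum_disjoint (I : eqType) (s : seq I) (c : I -> R) : uniq s ->
  (forall k l, k != l -> c k * c l = 0) ->
  (\sum_(k <- s) c k) ^+ 2 = \sum_(k <- s) c k ^+ 2.
Proof.
move=> us cd; elim: s us => [|k s IH] /=; first by rewrite !big_nil expr0n.
move=> /andP[ks us]; rewrite !big_cons sqrrD IH//.
have -> : c k * (\sum_(j <- s) c j) = 0.
  rewrite mulr_sumr big_seq big1// => l ls; apply: cd.
  by apply: contraNneq ks => ->.
by rewrite mul0rn addr0.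
Qed.

(** The dyadic shells do not overlap, so gradients of different bumps are never
simultaneously nonzero. *)
Lemma dbump_disjoint n (k l : nat) (x : 'rV[R]_n) i : k != l ->
  dbump (4 ^+ k.+1) i x * dbump (4 ^+ l.+1) i x = 0.
Proof.
wlog kl : k l / (k < l)%N.
  move=> H; rewrite neq_ltn => /orP[h|h]; first by apply: H => //; rewrite ltn_eqF.
  by rewrite mulrC; apply: H => //; rewrite ltn_eqF.
move=> _; have p m : 0 < 4 ^+ m :> R by rewrite exprn_gt0.
have [h|h] := leP (4 * 4 ^+ k.+1) (sqnorm x).
  by have [_ ->] := bump_outside (p _) h; rewrite mul0r.
have xl : sqnorm x <= 4 ^+ l.+1.
  by apply: (le_trans (ltW h)); rewrite -exprS ler_weXn2l// ler1n.
by have [_ ->] := bump_inside (p _) xl; rewrite mulr0.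
Qed.

(** The gradient of a bump between radii r and 2r has squared size at most
16/r^2. *)
Lemma Rn_int_bump_grad n (W : 'rV[R]_n -> R) (r m : R) : 0 < r ->
  continuous W -> (forall x, 0 <= W x) -> mass_le W (2 * r) m ->
  Rn_int (fun x => W x * \sum_i dbump (n := n) (r ^+ 2) i x ^+ 2) <= 16 / r ^+ 2 * m.
Proof.
move=> r0 cW W0 hm; have rho0 : 0 < r ^+ 2 by rewrite exprn_gt0.
set E := (fun x => _).
have ccE : ccont E.
  apply: ccontMl => //; apply: ccont_sum => i; apply: ccont_sqr.
  exact: (cutoff_grad_ccont (bump_cutoff n rho0)).
have q0 : 0 <= r ^+ 2 / 16 by rewrite divr_ge0// ltW.
have : Rn_int (fun x => r ^+ 2 / 16 * E x) <= m.
  apply: hm; first exact: ccontZ.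
    move=> x; apply/andP; split.
      by apply: mulr_ge0 => //; apply: mulr_ge0 => //; apply: sumr_ge0 => i _; exact: sqr_ge0.
    rewrite mulrCA -[leRHS]mulr1 ler_wpM2l//.
    apply: (le_trans (ler_wpM2l q0 (bump_grad x rho0))).
    by rewrite le_eqVlt; apply/orP; left; apply/eqP; field; rewrite gt_eqF.
  move=> x h; rewrite /E big1 ?mulr0// => i _.
  have h4 : 4 * r ^+ 2 <= sqnorm x by apply: le_trans h; rewrite exprMn -natrX.
  by have [_ ->] := bump_outside rho0 h4; rewrite expr0n.
rewrite Rn_intZ// => h.
rewrite -[X in X <= _](_ : 16 / r ^+ 2 * (r ^+ 2 / 16 * Rn_int E) = _).
  by rewrite ler_wpM2l// divr_ge0// ltW.
by field; rewrite gt_eqF.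
Qed.

(** A weight of mass O(4^k b_k) in the ball of radius 2^(k+2) with the series of
1/b_k divergent is parabolic: it admits cutoffs with arbitrarily small Dirichlet
energy. A single bump at scale 2^k has energy of order b_k. Averaging the bumps
with weights 1/b_k, and using that their gradients live in disjoint shells, the
total energy is of order (sum b_k^-2 b_k) / (sum b_k^-1)^2 = 1 / sum b_k^-1. *)
Lemma log_cutoff n (W : 'rV[R]_n -> R) (C : R) (b : nat -> R) :
  continuous W -> (forall x, 0 <= W x) -> 0 <= C -> (forall k, 0 < b k) ->
  (forall k, mass_le W (2 ^+ k.+2) (C * 4 ^+ k * b k)) ->
  (forall A, exists N, A <= \sum_(k < N) (b k)^-1) ->
  forall rho e, 0 < e -> exists phi, exists2 dphi, is_cutoff rho phi dphi &
    Rn_int (fun x => W x * \sum_i dphi i x ^+ 2) <= e.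
Proof.
move=> cW W0 C0 b0 hmass hser rho e e0.
have p m : 0 < 4 ^+ m :> R by rewrite exprn_gt0.
(* The scales below m are dropped so that phi = 1 on the prescribed ball; they
   contribute finitely many terms to the divergent series. *)
have [m rm] : exists m, rho <= 4 ^+ m.+1.
  exists (Num.truncn `|rho|); apply: (le_trans (ler_norm _)).
  apply: (le_trans (ltW (Num.Theory.truncnS_gt _))).
  by rewrite -natrX ler_nat ltnW// ltn_expl.
pose A := 4 * C / e + 1.
have A0 : 0 < A by rewrite ltr_wpDl// divr_ge0 ?(ltW e0)// mulr_ge0.
have [N hN] := hser (A + \sum_(k < m) (b k)^-1).
have mN : (m <= N)%N.
  rewrite leqNgt; apply/negP => Nm; move: hN; apply/negP; rewrite -ltNge.
  apply: (@le_lt_trans _ _ (\sum_(k < m) (b k)^-1)); last by rewrite ltrDr.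
  rewrite -!(big_mkord xpredT (fun k => (b k)^-1)) (big_cat_nat (leq0n N) (ltnW Nm))//= lerDl.
  by apply: sumr_ge0 => k _; rewrite invr_ge0 ltW.
pose s := index_iota m N.
pose S := \sum_(k <- s) (b k)^-1.
have AS : A <= S.
  move: hN; rewrite -!(big_mkord xpredT (fun k => (b k)^-1)) (big_cat_nat (leq0n m) mN)/=.
  by rewrite -/S [leLHS]addrC lerD2l.
have S0 : 0 < S by exact: lt_le_trans AS.
pose a k := S^-1 * (b k)^-1.
have a0 k : 0 < a k by rewrite mulr_gt0// invr_gt0.
pose phi x := \sum_(k <- s) a k * bump (n := n) (4 ^+ k.+1) x.
pose dphi (i : 'I_n) x := \sum_(k <- s) a k * dbump (4 ^+ k.+1) i x.
have suma : \sum_(k <- s) a k = 1 by rewrite -mulr_sumr mulVf// gt_eqF.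
exists phi, dphi.
  split.
  - by apply: C1_sum => k; apply: C1Z; case: (bump_cutoff n (p k.+1)).
  - move=> x; apply/andP; split.
      apply: sumr_ge0 => k _; rewrite mulr_ge0 ?(ltW (a0 _))//.
      by have /andP[] := step_itv ((4 ^+ k.+1)^-1 * sqnorm x).
    rewrite -suma; apply: ler_sum => k _; rewrite ler_piMr ?(ltW (a0 _))//.
    by have /andP[] := step_itv ((4 ^+ k.+1)^-1 * sqnorm x).
  - move=> x xr.
    have E k : k \in s -> bump (4 ^+ k.+1) x = 1 /\ forall i, dbump (4 ^+ k.+1) i x = 0.
      rewrite mem_index_iota => /andP[mk _]; apply: bump_inside => //.
      by apply: (le_trans xr); apply: (le_trans rm); rewrite ler_weXn2l// ler1n.
    split; first by rewrite -suma; apply: eq_big_seq => k /E[-> _]; rewrite mulr1.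
    by move=> i; rewrite /dphi big_seq big1// => k /E[_ ->]; rewrite mulr0.
  - exists (4 * 4 ^+ N.+1) => x xr.
    have E k : k \in s -> bump (4 ^+ k.+1) x = 0 /\ forall i, dbump (4 ^+ k.+1) i x = 0.
      rewrite mem_index_iota => /andP[_ kN]; apply: bump_outside => //.
      apply: le_trans xr; rewrite ler_pM2l// ler_weXn2l// ?ler1n// ltnW//.
    split; first by rewrite /phi big_seq big1// => k /E[-> _]; rewrite mulr0.
    by move=> i; rewrite /dphi big_seq big1// => k /E[_ ->]; rewrite mulr0.
have ccI k : ccont (fun x => W x * \sum_i dbump (n := n) (4 ^+ k.+1) i x ^+ 2).
  apply: ccontMl => //; apply: ccont_sum => i; apply: ccont_sqr.
  exact: (cutoff_grad_ccont (bump_cutoff n (p k.+1))).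
have E x : W x * \sum_i dphi i x ^+ 2 =
   \sum_(k <- s) a k ^+ 2 * (W x * \sum_i dbump (4 ^+ k.+1) i x ^+ 2).
  transitivity (W x * \sum_i \sum_(k <- s) a k ^+ 2 * dbump (4 ^+ k.+1) i x ^+ 2).
    congr (_ * _); apply: eq_bigr => i _; rewrite sqr_sum_disjoint ?iota_uniq//.
      by apply: eq_bigr => k _; rewrite exprMn.
    by move=> k l kl; rewrite mulrACA dbump_disjoint// mulr0.
  rewrite exchange_big /= mulr_sumr; apply: eq_bigr => k _.
  by rewrite -mulr_sumr mulrCA.
rewrite (eq_Rn_int E) Rn_int_sum; last by move=> k; exact: ccontZ.
have Ik k : Rn_int (fun x => W x * \sum_i dbump (n := n) (4 ^+ k.+1) i x ^+ 2) <= 4 * C * b k.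
  have H := Rn_int_bump_grad (exprn_gt0 k.+1 (ltr0n R 2)) cW W0 (hmass k).
  have E4 : (2 ^+ k.+1) ^+ 2 = 4 ^+ k.+1 :> R.
    by rewrite -exprM mulnC exprM -natrX.
  rewrite E4 in H; apply: (le_trans H).
  rewrite le_eqVlt; apply/orP; left; apply/eqP; rewrite exprS; field.
  by rewrite gt_eqF.
apply: (@le_trans _ _ (\sum_(k <- s) S^-1 * (4 * C) * a k)).
  apply: ler_sum => k _; rewrite Rn_intZ//.
  apply: (@le_trans _ _ (a k ^+ 2 * (4 * C * b k))).
    by rewrite ler_wpM2l// sqr_ge0.
  rewrite le_eqVlt; apply/orP; left; apply/eqP; rewrite /a; field.
  by rewrite !gt_eqF.
rewrite -mulr_sumr suma mulr1 mulrC ler_pdivrMr//.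
apply: (@le_trans _ _ (e * A)); last by rewrite ler_pM2l.
rewrite /A mulrDr mulr1 [e * _]mulrC divfK ?gt_eqF// lerDl ltW//.
Qed.

End cutoff.

(** * The energy inequality and its Liouville property *)

Section energy.
Context {R : realType}.
Variable n : nat.
Implicit Types (u phi w : 'rV[R]_n -> R).

Lemma Rn_int_div (Z : 'I_n -> 'rV[R]_n -> R) (dZ : 'I_n -> 'I_n -> 'rV[R]_n -> R) L :
  (forall i, C1 (Z i) (dZ i)) ->
  (forall i x, L <= sqnorm x -> Z i x = 0 /\ dZ i i x = 0) ->
  ccont (fun x => \sum_i dZ i i x) /\ Rn_int (fun x => \sum_i dZ i i x) = 0.
Proof.
move=> CZ hL.
have ccdZ i : ccont (dZ i i).
  by case: (CZ i) => _ _ c; split=> //; exists L => x Lx; case: (hL i x Lx).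
have ccontZ i : ccont (Z i).
  by case: (CZ i) => c _ _; split=> //; exists L => x Lx; case: (hL i x Lx).
split; first exact: ccont_sum.
rewrite Rn_int_sum//; apply: big1 => i _.
by apply: (Rn_int_derive (ccontZ i) (ccdZ i)) => x; case: (CZ i) => _ + _; apply.
Qed.

(** The divergence of phi^2 (u - m) w grad u has zero integral. The sign hypothesis
discards the zero-order term, and completing a square absorbs the cross term
2 phi (u - m) grad phi . grad u into half of the energy. The coefficients c
allow a constant anisotropy, needed for the slices of the final step. *)
Lemma caccioppoli (c : 'I_n -> R) w u du fl (m B rho : R) phi dphi :
  (forall i, 0 <= c i) -> continuous w -> (forall x, 0 <= w x) ->
  C1 u du -> (forall i, C1 (fun x => w x * du i x) (fl i)) ->
  (forall x, 0 <= (\sum_i c i * fl i i x) * (u x - m)) ->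
  (forall x, `|u x - m| <= B) -> is_cutoff rho phi dphi ->
  Rn_int (fun x => w x * (\sum_i c i * du i x ^+ 2) * phi x ^+ 2) <=
  4 * B ^+ 2 * Rn_int (fun x => w x * \sum_i c i * dphi i x ^+ 2).
Proof.
move=> c0 cw w0 Cu Cfl eq uB hphi.
have Cphi := cutoff_C1 hphi; have [L hL] := cutoff_supp hphi.
have [cu _ cdu] := Cu.
have ccphi := cutoff_ccont hphi; have ccdphi := cutoff_grad_ccont hphi.
have Cum : C1 (fun x => u x + - m) (fun i x => du i x + 0) by exact: C1D Cu (C1_cst _ _).
pose C2 := C1M (C1M Cphi Cphi) Cum.
have CZ i := C1Z (c i) (C1M C2 (Cfl i)).
have [] := Rn_int_div (L := L) CZ.
  by move=> i x /hL[h1 h2]; rewrite h1 h2; split; ring.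
set DZ := (fun x => \sum_i _) => ccDZ IDZ.
pose E x := w x * (\sum_i c i * du i x ^+ 2) * phi x ^+ 2.
pose G x := w x * \sum_i c i * dphi i x ^+ 2.
have ccE : ccont E.
  apply: ccontMl; last exact: ccont_sqr.
  by apply: continuous_mul => //; apply: continuous_bigsum => i;
    apply: continuous_mul; [exact: cst_continuous|exact: continuous_sqr].
have ccG : ccont G.
  by apply: ccontMl => //; apply: ccont_sum => i; apply: ccontZ; exact: ccont_sqr.
rewrite -/E -/G.
have key : Rn_int (fun x => 2^-1 * E x + (- (2 * B ^+ 2)) * G x) <= Rn_int DZ.
  apply: le_Rn_int => //; first by apply: ccontD; exact: ccontZ.
  move=> x; have H := eq x.
  apply: (@le_trans _ _ (DZ x - (phi x ^+ 2) * ((\sum_i c i * fl i i x) * (u x - m)))); last first.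
    by rewrite lerBlDr lerDl mulr_ge0// sqr_ge0.
  rewrite /E /G /DZ mulr_suml !(mulr_sumr, mulr_suml) -!big_split /= -sumrN -big_split /=.
  apply: ler_sum => i _.
  have uB2 : (u x - m) ^+ 2 <= B ^+ 2.
    by rewrite -(real_normK (num_real (u x - m))) ler_pXn2r// nnegrE// (le_trans _ (uB x)).
  rewrite -subr_ge0.
  set a := phi x; set b := dphi i x; set p := du i x; set v := u x - m.
  have -> : c i * (a * a * v * fl i i x + w x * p * (a * a * (p + 0) + v * (a * b + a * b)))
     - a ^+ 2 * (c i * fl i i x * v) -
     (2^-1 * (w x * (c i * p ^+ 2) * a ^+ 2) + - (2 * B ^+ 2) * (w x * (c i * b ^+ 2))) =
     w x * (c i * (2^-1 * (a * p + 2 * v * b) ^+ 2 + 2 * (B ^+ 2 - v ^+ 2) * b ^+ 2)).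
    by field.
  rewrite mulr_ge0// mulr_ge0// addr_ge0// mulr_ge0// ?sqr_ge0 ?invr_ge0//.
  by rewrite mulr_ge0// subr_ge0.
move: key; rewrite IDZ Rn_intD ?Rn_intZ//; last 2 first.
- exact: ccontZ.
- exact: ccontZ.
move: (Rn_int E) (Rn_int G) => X Y; lra.
Qed.

(** Domination by F on a ball replaces the integral of H over this ball, which is
then at most e for every e > 0; [Rn_int_eq0] concludes. *)
Lemma vanishing (H : 'rV[R]_n -> R) : continuous H -> (forall x, 0 <= H x) ->
  (forall rho e, 0 < e -> exists F, [/\ ccont F, forall x, 0 <= F x, Rn_int F <= e &
      forall x, sqnorm x <= rho -> H x <= F x]) ->
  forall x, H x = 0.
Proof.
move=> cH H0 hF x.
pose rho := sqnorm x + 1.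
have rho0 : 0 < rho by rewrite ltr_wpDl// sqnorm_ge0.
have hc := bump_cutoff n rho0.
pose G y := H y * bump rho y ^+ 2.
have ccG : ccont G by apply: ccontMl => //; apply: ccont_sqr; exact: cutoff_ccont hc.
have G0 y : 0 <= G y by rewrite mulr_ge0// sqr_ge0.
have IG : Rn_int G <= 0.
  apply/ler_addgt0Pl => e e0; rewrite addr0.
  have [F [ccF F0 FI HF]] := hF (4 * rho) e e0.
  apply: le_trans FI; apply: le_Rn_int => // y; rewrite /G.
  have [h|h] := leP (4 * rho) (sqnorm y); first by have [-> _] := bump_outside rho0 h; rewrite expr0n mulr0.
  apply: le_trans (HF y (ltW h)); rewrite ler_piMr//.
  by have /andP[? ?] := cutoff_itv hc y; rewrite expr_le1.
have := Rn_int_eq0 ccG G0 IG x; rewrite /G.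
have xr : sqnorm x <= rho by rewrite lerDl.
by have [-> _] := cutoff1 hc xr; rewrite expr1n mulr1.
Qed.

(** By [caccioppoli] the energy of u is controlled by the Dirichlet energy of the
cutoff, which [log_cutoff] makes arbitrarily small. The conclusion keeps the
coefficient c i, which is allowed to vanish. *)
Lemma energy_liouville (c : 'I_n -> R) w u du fl (m B C : R) (b : nat -> R) :
  (forall i, 0 <= c i) -> continuous w -> (forall x, 0 < w x) ->
  C1 u du -> (forall i, C1 (fun x => w x * du i x) (fl i)) ->
  (forall x, 0 <= (\sum_i c i * fl i i x) * (u x - m)) ->
  (forall x, `|u x - m| <= B) ->
  0 <= C -> (forall k, 0 < b k) ->
  (forall k, mass_le w (2 ^+ k.+2) (C * 4 ^+ k * b k)) ->
  (forall A, exists N, A <= \sum_(k < N) (b k)^-1) ->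
  forall i x, c i * du i x ^+ 2 = 0.
Proof.
move=> c0 cw w0 Cu Cfl eq uB C0 b0 hmass hser.
have [_ _ cdu] := Cu; have w_ge0 x : 0 <= w x by exact: ltW.
pose kappa := \sum_i c i.
have kappa0 : 0 <= kappa by exact: sumr_ge0.
have c_le i : c i <= kappa by rewrite /kappa (bigD1 i)//= lerDl sumr_ge0.
have cen : continuous (fun x => w x * \sum_i c i * du i x ^+ 2).
  apply: continuous_mul => //; apply: continuous_bigsum => i; apply: continuous_mul.
    exact: cst_continuous.
  exact: continuous_sqr.
have en0 x : 0 <= w x * \sum_i c i * du i x ^+ 2.
  by apply: mulr_ge0 => //; apply: sumr_ge0 => i _; apply: mulr_ge0 => //; exact: sqr_ge0.
have H0 x : w x * \sum_i c i * du i x ^+ 2 = 0.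
  move: x; apply: vanishing => // rho e e0.
  (* The cutoff must absorb the constants of the energy inequality. *)
  pose D := 4 * B ^+ 2 * kappa + 1.
  have B0 : 0 <= 4 * B ^+ 2 by rewrite mulr_ge0// sqr_ge0.
  have D0 : 0 < D by rewrite ltr_wpDl// mulr_ge0.
  have [phi [dphi hphi Ie]] := log_cutoff cw w_ge0 C0 b0 hmass hser rho (divr_gt0 e0 D0).
  have ccdphi := cutoff_grad_ccont hphi.
  exists (fun x => w x * (\sum_i c i * du i x ^+ 2) * phi x ^+ 2); split.
  - by apply: ccontMl => //; apply: ccont_sqr; exact: cutoff_ccont hphi.
  - by move=> x; rewrite mulr_ge0 ?sqr_ge0.
  - apply: (le_trans (caccioppoli c0 cw w_ge0 Cu Cfl eq uB hphi)).
    have cmp : Rn_int (fun x => w x * \sum_i c i * dphi i x ^+ 2) <=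
        kappa * Rn_int (fun x => w x * \sum_i dphi i x ^+ 2).
      rewrite -Rn_intZ; last by apply: ccontMl => //; apply: ccont_sum => i; exact: ccont_sqr.
      apply: le_Rn_int.
      - by apply: ccontMl => //; apply: ccont_sum => i; apply: ccontZ; exact: ccont_sqr.
      - by apply: ccontZ; apply: ccontMl => //; apply: ccont_sum => i; exact: ccont_sqr.
      move=> x; rewrite mulrCA ler_wpM2l// mulr_sumr ler_sum// => i _.
      by rewrite ler_wpM2r// sqr_ge0.
    apply: (le_trans (ler_wpM2l B0 cmp)).
    apply: (le_trans (ler_wpM2l B0 (ler_wpM2l kappa0 Ie))).
    by rewrite mulrA mulrA ler_pdivrMr// mulrC ler_pM2l// /D lerDl.
  - by move=> x xr; have [-> _] := cutoff1 hphi xr; rewrite expr1n mulr1.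
move=> i x; have /eqP := H0 x; rewrite mulf_eq0 (gt_eqF (w0 x)) /= psumr_eq0.
  by move=> /allP/(_ i); rewrite mem_index_enum => /(_ isT)/eqP.
by move=> l _; apply: mulr_ge0 => //; exact: sqr_ge0.
Qed.

End energy.

(** * Second derivatives and difference quotients *)

Section second_order.
Context {R : realType}.
Variable n : nat.
Implicit Types (u phi w F : 'rV[R]_n -> R).

Lemma continuous_delta F (x : 'rV[R]_n) (e : R) : continuous F -> 0 < e ->
  exists2 d : R, 0 < d & forall y : 'rV[R]_n, (forall i, `|x 0 i - y 0 i| < d) -> `|F x - F y| < e.
Proof.
move=> cF e0; have /cvg_ballP/(_ _ e0) := cF x; move=> /nbhs_ballP[d /= d0 hd].
by exists d => // y hy; apply: hd; split => // a b; rewrite ord1; exact: hy.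
Qed.

Lemma is_derive_transl (F : 'rV[R]_n -> R) (z x : 'rV[R]_n) v d :
  is_derive (z + x) v F d -> is_derive x v (fun y => F (z + y)) d.
Proof. by move=> D; apply: (is_derive_line _ D) => h; rewrite addrCA. Qed.

Lemma continuous_transl F (z : 'rV[R]_n) : continuous F -> continuous (fun y => F (z + y)).
Proof.
move=> cF x; have cz : continuous (fun y : 'rV[R]_n => z + y).
  apply: continuous_lip => a e e0; exists e => // b hb k.
  by rewrite !mxE opprD addrACA subrr add0r; exact: hb.
exact: (continuous_comp (cz x) (cF (z + x))).
Qed.

Lemma C1_transl F dF (z : 'rV[R]_n) : C1 F dF -> C1 (fun y => F (z + y)) (fun i y => dF i (z + y)).
Proof.
move=> [cF D cdF]; split=> [|i x|i].
- exact: continuous_transl.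
- exact: is_derive_transl (D i _).
- exact: continuous_transl.
Qed.

(** The second difference of u over a small rectangle equals, by two applications
of the mean value theorem in either order, each of the two mixed derivatives at
nearby points; continuity concludes. *)
Lemma schwarz u du (i j : 'I_n) ddi ddj x : C1 u du -> C1 (du i) ddi -> C1 (du j) ddj ->
  ddi j x = ddj i x.
Proof.
move=> Cu Ci Cj; apply/eqP; rewrite -subr_eq0 -normr_le0 leNgt; apply/negP => h0.
pose e := `|ddi j x - ddj i x| / 2.
have e0 : 0 < e by rewrite divr_gt0.
have [_ _ /(_ j) c1] := Ci; have [_ _ /(_ i) c2] := Cj.
have [d1 d10 h1] := continuous_delta x c1 e0.
have [d2 d20 h2] := continuous_delta x c2 e0.
(* A third: the intermediate points are at distance at most 2h from x. *)
pose h := Num.min d1 d2 / 3.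
have hh : 0 < h by rewrite divr_gt0// lt_min d10.
have second (k l : 'I_n) (ddk : 'I_n -> 'rV[R]_n -> R) : C1 (du k) ddk ->
    exists t t', [/\ `|t| <= h, `|t'| <= h &
   (u (h *: e_ l + (h *: e_ k + x)) - u (h *: e_ k + x)) - (u (h *: e_ l + x) - u x) =
   h * (h * ddk l (t' *: e_ l + (t *: e_ k + x)))].
  move=> Ck; have [_ Du _] := Cu; have [_ Dk _] := Ck.
  have D y : is_derive y (e_ k) (fun y => u (h *: e_ l + y) - u y)
      (du k (h *: e_ l + y) - du k y).
    have A1 := is_derive_transl (Du k (h *: e_ l + y)); have A2 := Du k y.
    exact: is_deriveB.
  have [t th ->] := mvt_line x h D.
  have [t' th' ->] := mvt_line (t *: e_ k + x) h (Dk l).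
  by exists t, t'; rewrite -(gtr0_norm hh).
have [t [t' [th th' E1]]] := second i j ddi Ci.
have [s [s' [sh sh' E2]]] := second j i ddj Cj.
have close (a b : R) (k l : 'I_n) : `|a| <= h -> `|b| <= h ->
    forall m, `|x 0 m - (a *: e_ k + (b *: e_ l + x)) 0 m| < Num.min d1 d2.
  move=> ah bh m; rewrite distrC.
  have A1 := e_coord_dist k m a (b *: e_ l + x); have A2 := e_coord_dist l m b x.
  apply: (@le_lt_trans _ _ (h + h)); last first.
    have : 0 < Num.min d1 d2 by rewrite lt_min d10.
    by rewrite /h; move: (Num.min d1 d2) => z; lra.
  apply: le_trans (lerD (le_trans A1 ah) (le_trans A2 bh)).
  by rewrite -[X in `|X|](subrKA ((b *: e_ l + x) 0 m)); exact: ler_normD.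
have B1 : `|ddi j x - ddi j (t' *: e_ j + (t *: e_ i + x))| < e.
  by apply: h1 => m; have := close t' t j i th' th m; rewrite lt_min => /andP[].
have B2 : `|ddj i x - ddj i (s' *: e_ i + (s *: e_ j + x))| < e.
  by apply: h2 => m; have := close s' s i j sh' sh m; rewrite lt_min => /andP[].
have AB : ddi j (t' *: e_ j + (t *: e_ i + x)) = ddj i (s' *: e_ i + (s *: e_ j + x)).
  have h_neq0 : h != 0 by rewrite gt_eqF.
  apply: (mulfI h_neq0); apply: (mulfI h_neq0); rewrite -E1 -E2.
  by rewrite [h *: e_ i + (h *: e_ j + x)]addrCA; ring.
have : `|ddi j x - ddj i x| < e + e.
  rewrite -[X in `|X|](subrKA (ddi j (t' *: e_ j + (t *: e_ i + x)))).
  apply: (le_lt_trans (ler_normD _ _)); apply: ltrD => //.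
  by rewrite AB distrC.
by rewrite /e; move: `|_| => z; lra.
Qed.

Definition diffq (j : 'I_n) (h : R) F x := h^-1 * (F (h *: e_ j + x) - F x).

Lemma diffq_mvt F (j : 'I_n) dF x (h : R) : h != 0 -> (forall y, is_derive y (e_ j) F (dF y)) ->
  exists2 t, `|t| <= `|h| & diffq j h F x = dF (t *: e_ j + x).
Proof.
move=> h0 D; have [t th E] := mvt_line x h D.
by exists t => //; rewrite /diffq E mulKf.
Qed.

Lemma diffq_cvg F (j : 'I_n) dF x : (forall y, is_derive y (e_ j) F (dF y)) -> continuous dF ->
  diffq j m.+1%:R^-1 F x @[m --> \oo] --> dF x.
Proof.
move=> D cdF; apply/cvgrPdist_lt => e e0.
have [d d0 hd] := continuous_delta x cdF e0.
near=> m.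
have h0 : (m.+1%:R^-1 : R) != 0 by rewrite invr_eq0 pnatr_eq0.
have [t th ->] := diffq_mvt x h0 D.
apply: hd => i; rewrite distrC; apply: (le_lt_trans (e_coord_dist _ _ _ _)).
apply: (le_lt_trans th); rewrite ger0_norm//; near: m.
exact: (near_infty_natSinv_lt (PosNum d0)).
Unshelve. all: by end_near.
Qed.

Lemma C1_diffq F dF j h : C1 F dF -> C1 (diffq j h F) (fun i => diffq j h (dF i)).
Proof.
move=> CF; apply: (C1_ext (C1Z h^-1 (C1D (C1_transl (h *: e_ j) CF) (C1N CF)))) => //.
Qed.

End second_order.

(** * Derivatives of a stable solution in an invariant direction *)

Section linearized.
Context {R : realType}.
Variable n : nat.
Implicit Types (u phi w la : 'rV[R]_n -> R).

Lemma cvg_seqsum (I : Type) (s : seq I) (F : I -> nat -> R) (l : I -> R) :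
  (forall i, F i m @[m --> \oo] --> l i) ->
  \sum_(i <- s) F i m @[m --> \oo] --> \sum_(i <- s) l i.
Proof.
move=> h; elim: s => [|i s IH].
  by rewrite big_nil; under eq_fun do rewrite big_nil; exact: cvg_cst.
by rewrite big_cons; under eq_fun do rewrite big_cons; exact: cvgD.
Qed.

Lemma grad_transl_invariant w dw (j : 'I_n) (h : R) : C1 w dw ->
  (forall x, w (h *: e_ j + x) = w x) -> forall i x, dw i (h *: e_ j + x) = dw i x.
Proof.
move=> Cw hw i x.
have E : (fun y => w (h *: e_ j + y)) = w by apply/funext => y; exact: hw.
have := C1_partial i x (C1_transl (h *: e_ j) Cw); rewrite E (C1_partial i x Cw).
by [].
Qed.

(** Differentiating the equation in the direction j would need third derivatives of
u. Instead the difference quotient of u, which is C^2, is inserted in the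
equation; w and la are invariant in the direction j, so it solves a linear
equation with the difference quotient of f(u) on the right. Testing with
phi^2 times the difference quotient and letting the step tend to 0 by
dominated convergence gives the weak linearized equation tested with phi^2 du_j,
where only second derivatives of u appear. *)
Lemma weak_linearized w dw la (f : R -> R) u du ddu (j : 'I_n) rho phi dphi :
  C1 w dw -> (forall h x, w (h *: e_ j + x) = w x) ->
  continuous la -> (forall h x, la (h *: e_ j + x) = la x) ->
  (forall t, derivable f t 1) -> continuous (derive1 f) ->
  C1 u du -> (forall i, C1 (du i) (ddu i)) ->
  (forall x, - (\sum_i (w x * ddu i i x + du i x * dw i x)) = la x * f (u x)) ->
  is_cutoff rho phi dphi ->
  let T x := \sum_i w x * ddu i j x * (phi x ^+ 2 * ddu i j x + 2 * phi x * dphi i x * du j x)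
       - phi x ^+ 2 * du j x * (la x * (derive1 f (u x) * du j x)) in
  ccont T /\ Rn_int T = 0.
Proof.
move=> Cw hw cla hla df cf' Cu Cdu eq hphi T.
have Cphi := cutoff_C1 hphi; have [L hL] := cutoff_supp hphi.
have ccphi := cutoff_ccont hphi; have ccdphi := cutoff_grad_ccont hphi.
have [cw _ cdw] := Cw; have [cu Du cdu] := Cu; have [cphi _ cdphi] := Cphi.
have cddu i k : continuous (ddu i k) by case: (Cdu i).
have Dfu y : is_derive y (e_ j) (fun y => f (u y)) (derive1 f (u y) * du j y).
  have Df (t : R) : is_derive t 1 f (derive1 f t).
    by apply: DeriveDef; [exact: df|rewrite derive1E].
  exact: (is_derive_comp (Du j y) (Df (u y))).
have cfu : continuous (fun y => derive1 f (u y) * du j y).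
  by apply: continuous_mul => // y; apply: continuous_comp; [exact: cu|exact: cf'].
have cf : continuous (fun y => f (u y)).
  move=> y; apply: continuous_comp; first exact: cu.
  by apply: differentiable_continuous; apply/derivable1_diffP; exact: df.
have cdq (h : R) (F : 'rV[R]_n -> R) : continuous F -> continuous (diffq j h F).
  move=> cF; apply: continuous_mul; first exact: cst_continuous.
  exact: (continuous_add (continuous_transl (z := h *: e_ j) cF) (continuous_opp cF)).
pose TT (A : 'I_n -> 'rV[R]_n -> R) (B D : 'rV[R]_n -> R) x : R :=
  \sum_i w x * A i x * (phi x ^+ 2 * A i x + 2 * phi x * dphi i x * B x)
       - phi x ^+ 2 * B x * (la x * D x).
have cTT A B D : (forall i, continuous (A i)) -> continuous B -> continuous D ->
    continuous (TT A B D).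
  move=> cA cB cD; apply: continuous_add; last apply: continuous_opp.
    apply: continuous_bigsum => i; repeat (apply: continuous_mul || apply: continuous_add) => //;
    exact: cst_continuous.
  by repeat (apply: continuous_mul => //).
have cT : continuous T.
  exact: (cTT (fun i => ddu i j) (du j) (fun x => derive1 f (u x) * du j x)).
have ccT : ccont T.
  split=> //; exists L => x /hL[h1 h2]; rewrite /T h1 big1 ?expr0n /= ?mul0r ?subr0//.
  by move=> i _; rewrite !mulr0 !mul0r addr0 mulr0.
split=> //.
pose Th h x := \sum_i w x * diffq j h (du i) x *
    (phi x ^+ 2 * diffq j h (du i) x + 2 * phi x * dphi i x * diffq j h u x)
       - phi x ^+ 2 * diffq j h u x * (la x * diffq j h (fun y => f (u y)) x).
have Th0 h : Rn_int (Th h) = 0.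
  pose CA := C1M (C1M Cphi Cphi) (C1_diffq j h Cu).
  have CZ i := C1M CA (C1M Cw (C1_diffq j h (Cdu i))).
  have [] := Rn_int_div (L := L) CZ.
    by move=> i x /hL[h1 h2]; rewrite h1 h2; split; ring.
  move=> _ IZ; rewrite -[RHS]IZ; apply: eq_Rn_int => x.
  (* The equation at x and at its translate, subtracted. *)
  have EL : \sum_i (w x * diffq j h (ddu i i) x + diffq j h (du i) x * dw i x) =
     - (la x * diffq j h (fun y => f (u y)) x).
    have := eq (h *: e_ j + x); have := eq x; rewrite /diffq.
    under [X in _ -> - X = _ -> _]eq_bigr do rewrite hw (grad_transl_invariant Cw (hw h)).
    rewrite hla => e1 e2.
    rewrite [RHS](_ : _ = h^-1 * (- (la x * f (u (h *: e_ j + x))) - - (la x * f (u x)))); last by ring.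
    rewrite -e1 -e2 !opprK -sumrB mulr_sumr.
    by apply: eq_bigr => i _; ring.
  rewrite /Th -[la x * _]opprK -EL mulrN opprK mulr_sumr -big_split /=.
  by apply: eq_bigr => i _; ring.
have [r r0 Lr] := sqr_bound L.
(* One continuous function dominating every factor: its maximum on the cube
   enlarged by 1 bounds them for all steps at most 1. *)
pose S x : R := `|w x| + `|la x| + 1 + \sum_i `|dphi i x| + `|du j x| + \sum_i `|ddu i j x|
   + `|derive1 f (u x) * du j x|.
have cnorm (F : 'rV[R]_n -> R) : continuous F -> continuous (fun x => `|F x|).
  by move=> cF x; apply: continuous_comp; [exact: cF|exact: norm_continuous].
have cS : continuous S.
  by repeat (apply: continuous_add => //); try (apply: continuous_bigsum => i); try exact: cnorm;
    exact: cst_continuous.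
have [M M0 hM] := @continuous_bounded R n S (r + 1) cS.
pose h_ m : R := m.+1%:R^-1.
have h_neq0 m : h_ m != 0 by rewrite invr_eq0 pnatr_eq0.
have h_le1 m : `|h_ m| <= 1 by rewrite /h_ ger0_norm ?invr_ge0// invf_le1 ?ltr0n// ler1n.
have Sge0 x : [/\ `|w x| <= S x, `|la x| <= S x, 1 <= S x & `|du j x| <= S x] /\
   `|derive1 f (u x) * du j x| <= S x /\ forall i, `|dphi i x| <= S x /\ `|ddu i j x| <= S x.
  have A1 := normr_ge0 (w x); have A2 := normr_ge0 (la x); have A3 := normr_ge0 (du j x).
  have A4 := normr_ge0 (derive1 f (u x) * du j x).
  have A5 : 0 <= \sum_i `|dphi i x| by apply: sumr_ge0.
  have A6 : 0 <= \sum_i `|ddu i j x| by apply: sumr_ge0.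
  split; first by rewrite /S; split; lra.
  split; first by rewrite /S; lra.
  move=> i.
  have B5 : `|dphi i x| <= \sum_i `|dphi i x| by rewrite (bigD1 i)//= lerDl sumr_ge0.
  have B6 : `|ddu i j x| <= \sum_i `|ddu i j x| by rewrite (bigD1 i)//= lerDl sumr_ge0.
  by rewrite /S; split; lra.
have dqM (F dF : 'rV[R]_n -> R) m (x : 'rV[R]_n) : (forall y, is_derive y (e_ j) F (dF y)) ->
    (forall y, `|dF y| <= S y) -> (forall i, `|x 0 i| <= r) -> `|diffq j (h_ m) F x| <= M.
  move=> D dFS xr; have [t th ->] := diffq_mvt x (h_neq0 m) D.
  apply: (le_trans (dFS _)); apply: (le_trans (ler_norm _)); apply: hM => i.
  rewrite -[X in `|X|](subrK (x 0 i)) (le_trans (ler_normD _ _))// addrC lerD//.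
  exact: (le_trans (e_coord_dist _ _ _ _) (le_trans th (h_le1 m))).
have cvgT : Rn_int (Th (h_ m)) @[m --> \oo] --> Rn_int T.
  apply: (@Rn_int_cvg R n (fun m => Th (h_ m)) T L (M ^+ 5 + \sum_(i < n) (3 * M ^+ 5))) => //.
  - move=> m; apply: (cTT (fun i => diffq j (h_ m) (du i)) (diffq j (h_ m) u)
      (diffq j (h_ m) (fun y => f (u y)))); by [exact: cdq|move=> i; exact: cdq].
  - move=> m x /hL[h1 h2]; rewrite /Th h1 big1 ?expr0n /= ?mul0r ?subr0//.
    by move=> i _; rewrite !mulr0 !mul0r addr0 mulr0.
  - move=> m x.
    have [/hL[h1 h2]|xL] := leP L (sqnorm x).
      rewrite /Th h1 big1 ?expr0n /= ?mul0r ?subr0 ?normr0; last first.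
        by move=> i _; rewrite !mulr0 !mul0r addr0 mulr0.
      by rewrite addr_ge0 ?exprn_ge0// sumr_ge0// => i _; rewrite mulr_ge0 ?exprn_ge0.
    have xr i : `|x 0 i| <= r.
      by apply: coord_le; [exact: ltW|exact: (le_trans (ltW xL) Lr)].
    have SM : S x <= M.
      apply: (le_trans (ler_norm _)); apply: hM => i.
      by rewrite (le_trans (xr i))// lerDl.
    have [[S1 S2 S3 S4] [S5 S6]] := Sge0 x.
    have wM := le_trans S1 SM; have lM := le_trans S2 SM.
    have pM : `|phi x| <= M.
      have /andP[p0 p1] := cutoff_itv hphi x.
      by rewrite ger0_norm// (le_trans p1)// (le_trans S3).
    have q1 : `|diffq j (h_ m) u x| <= M.
      by apply: (dqM u (du j)) => // y; have [[]] := Sge0 y.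
    have q2 : `|diffq j (h_ m) (fun y => f (u y)) x| <= M.
      by apply: (dqM _ _ m x Dfu) => // y; have [_ []] := Sge0 y.
    have q3 i : `|diffq j (h_ m) (du i) x| <= M.
      apply: (dqM _ (ddu i j)) => //; first by move=> y; case: (Cdu i) => _ + _; apply.
      by move=> y; have [_ [_ /(_ i)[]]] := Sge0 y.
    have mulM (a b A B : R) : `|a| <= A -> `|b| <= B -> `|a * b| <= A * B.
      by move=> ? ?; rewrite normrM ler_pM.
    have addM (a b A B : R) : `|a| <= A -> `|b| <= B -> `|a + b| <= A + B.
      by move=> ? ?; rewrite (le_trans (ler_normD _ _))// lerD.
    rewrite /Th addrC; apply: (addM _ _ _ _).
      rewrite normrN [leRHS](_ : _ = M * M * M * (M * M)); last by ring.
      exact: (mulM _ _ _ _ (mulM _ _ _ _ (mulM _ _ _ _ pM pM) q1) (mulM _ _ _ _ lM q2)).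
    apply: (le_trans (ler_norm_sum _ _ _)); apply: ler_sum => i _.
    have dM := le_trans (S6 i).1 SM.
    rewrite [leRHS](_ : _ = M * M * (M * M * M + 2 * M * M * M)); last by ring.
    have n2 : `|2 : R| <= 2 by rewrite ger0_norm.
    apply: (mulM _ _ _ _ (mulM _ _ _ _ wM (q3 i))); apply: (addM _ _ _ _).
      exact: (mulM _ _ _ _ (mulM _ _ _ _ pM pM) (q3 i)).
    exact: (mulM _ _ _ _ (mulM _ _ _ _ (mulM _ _ _ _ n2 pM) dM) q1).
  - move=> x; apply: cvgB.
      apply: cvg_seqsum => i.
      have c1 := diffq_cvg (x := x) (fun y => let: And3 _ D _ := Cdu i in D j y) (cddu i j).
      have c2 := diffq_cvg (x := x) (Du j) (cdu j).
      apply: cvgM; first by apply: cvgM; [exact: cvg_cst|exact: c1].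
      apply: cvgD; first by apply: cvgM; [exact: cvg_cst|exact: c1].
      by apply: cvgM; [exact: cvg_cst|exact: c2].
    have c2 := diffq_cvg (x := x) (Du j) (cdu j).
    have c3 := diffq_cvg (x := x) Dfu cfu.
    apply: cvgM; first by apply: cvgM; [exact: cvg_cst|exact: c2].
    by apply: cvgM; [exact: cvg_cst|exact: c3].
have : Rn_int (Th (h_ m)) @[m --> \oo] --> (0 : R).
  rewrite (_ : (fun m => _) = (fun=> 0)); first exact: cvg_cst.
  by apply/funext => m; exact: Th0.
by move=> /(cvg_unique _ cvgT) ->.
Qed.

End linearized.

Section stable.
Context {R : realType}.
Variable n : nat.

(** Put xi = phi du_j. Testing the equation of v with xi^2 / v and subtracting it
from [weak_linearized] leaves the identity
int w |grad xi - xi grad v / v|^2 = int w du_j^2 |grad phi|^2. Its integrand on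
the left is w v^2 |grad (du_j / v)|^2 wherever phi = 1, and its right-hand side
can be made arbitrarily small by [log_cutoff] with the weight w du_j^2. Hence
du_j / v has zero gradient. *)
Lemma stable_liouville (w la u v : 'rV[R]_n -> R) dw (f : R -> R)
    du ddu dv ddv (j : 'I_n) (C : R) (b : nat -> R) :
  C1 w dw -> (forall x, 0 < w x) -> (forall h x, w (h *: e_ j + x) = w x) ->
  continuous la -> (forall h x, la (h *: e_ j + x) = la x) ->
  (forall t, derivable f t 1) -> continuous (derive1 f) ->
  C1 u du -> (forall i, C1 (du i) (ddu i)) ->
  (forall x, - (\sum_i (w x * ddu i i x + du i x * dw i x)) = la x * f (u x)) ->
  C1 v dv -> (forall i, C1 (dv i) (ddv i)) -> (forall x, 0 < v x) ->
  (forall x, - (\sum_i (w x * ddv i i x + dv i x * dw i x)) = la x * derive1 f (u x) * v x) ->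
  0 <= C -> (forall k, 0 < b k) ->
  (forall k, mass_le (fun x => w x * du j x ^+ 2) (2 ^+ k.+2) (C * 4 ^+ k * b k)) ->
  (forall A, exists N, A <= \sum_(k < N) (b k)^-1) ->
  exists c, forall x, du j x = c * v x.
Proof.
move=> Cw w0 hw cla hla df cf' Cu Cdu eq Cv Cdv v0 eqv C0 b0 hmass hser.
have v_neq0 x : v x != 0 by rewrite gt_eqF.
have [cw _ cdw] := Cw; have [cv _ cdv] := Cv; have [cu _ cdu] := Cu.
have cddu i k : continuous (ddu i k) by case: (Cdu i).
pose K i x := ddu j i x - du j x * dv i x / v x.
have cK i : continuous (K i).
  apply: continuous_add => //; apply: continuous_opp; apply: continuous_mul.
    exact: continuous_mul.
  exact: continuous_inv.
have ident rho phi dphi : is_cutoff rho phi dphi ->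
    let F x := w x * \sum_i (phi x * K i x + du j x * dphi i x) ^+ 2 in
    ccont F /\ Rn_int F = Rn_int (fun x => w x * du j x ^+ 2 * \sum_i dphi i x ^+ 2).
  move=> hphi F; have [ccT IT] := weak_linearized Cw hw cla hla df cf' Cu Cdu eq hphi.
  have Cphi := cutoff_C1 hphi; have [L hL] := cutoff_supp hphi.
  have ccphi := cutoff_ccont hphi; have ccdphi := cutoff_grad_ccont hphi.
  set T := (fun x => _ - _) in ccT IT.
  pose Cxi := C1M Cphi (Cdu j).
  pose CA := C1M (C1M Cxi Cxi) (C1V Cv v_neq0).
  have CZ i := C1M CA (C1M Cw (Cdv i)).
  have [] := Rn_int_div (L := L) CZ.
    by move=> i x /hL[h1 h2]; rewrite h1 h2; split; ring.
  set Y := (fun x => \sum_i _) => ccY IY.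
  have ccF : ccont F.
    apply: ccontMl => //; apply: ccont_sum => i; apply: ccont_sqr; apply: ccontD.
      exact: ccontMr.
    exact: ccontMl.
  split=> //.
  have ccG : ccont (fun x => w x * du j x ^+ 2 * \sum_i dphi i x ^+ 2).
    apply: ccontMl; last by apply: ccont_sum => i; exact: ccont_sqr.
    by apply: continuous_mul => //; exact: continuous_sqr.
  have E x : F x = T x + (-1 * Y x + w x * du j x ^+ 2 * \sum_i dphi i x ^+ 2).
    have -> : Y x = phi x ^+ 2 * du j x ^+ 2 / v x * (\sum_i (w x * ddv i i x + dv i x * dw i x)) +
       \sum_i w x * dv i x * (- (phi x * du j x) ^+ 2 * v x ^- 2 * dv i x +
          (v x)^-1 * (2 * (phi x * du j x) * (phi x * ddu j i x + du j x * dphi i x))).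
      rewrite mulr_sumr -big_split /=; apply: eq_bigr => i _; by field; rewrite v_neq0.
    rewrite -[\sum_i (w x * _ + _)]opprK eqv /T.
    rewrite [RHS](_ : _ = \sum_i w x * ddu i j x * (phi x ^+ 2 * ddu i j x + 2 * phi x * dphi i x * du j x)
       + (- (\sum_i w x * dv i x * (- (phi x * du j x) ^+ 2 * v x ^- 2 * dv i x +
          (v x)^-1 * (2 * (phi x * du j x) * (phi x * ddu j i x + du j x * dphi i x))))
       + w x * du j x ^+ 2 * \sum_i dphi i x ^+ 2)); last first.
      by field; rewrite v_neq0.
    rewrite /F !mulr_sumr -sumrN -!big_split /=; apply: eq_bigr => i _.
    rewrite (schwarz x Cu (Cdu i) (Cdu j)) /K.
    by field; rewrite v_neq0.
  rewrite (eq_Rn_int E) Rn_intD//; last by apply: ccontD => //; exact: ccontZ.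
  by rewrite IT add0r Rn_intD ?Rn_intZ// ?IY ?mulr0 ?add0r//; exact: ccontZ.
have K0 i x : K i x = 0.
  suff H0 : w x * \sum_i K i x ^+ 2 = 0.
    move/eqP: H0; rewrite mulf_eq0 (gt_eqF (w0 x)) /= psumr_eq0; last by move=> k _; exact: sqr_ge0.
    by move=> /allP/(_ i); rewrite mem_index_enum => /(_ isT) /=; rewrite sqrf_eq0 => /eqP.
  move: x; apply: vanishing.
  - apply: continuous_mul => //; apply: continuous_bigsum => k; exact: continuous_sqr.
  - by move=> x; rewrite mulr_ge0 ?(ltW (w0 _))//; apply: sumr_ge0 => k _; exact: sqr_ge0.
  move=> rho e e0.
  have cW : continuous (fun x => w x * du j x ^+ 2).
    by apply: continuous_mul => //; exact: continuous_sqr.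
  have W0 x : 0 <= w x * du j x ^+ 2 by rewrite mulr_ge0 ?sqr_ge0// ltW.
  have [phi [dphi hphi Ie]] := log_cutoff cW W0 C0 b0 hmass hser rho e0.
  have [ccF IF] := ident _ _ _ hphi.
  exists (fun x => w x * \sum_i (phi x * K i x + du j x * dphi i x) ^+ 2); split=> //.
  - by move=> x; rewrite mulr_ge0 ?(ltW (w0 _))//; apply: sumr_ge0 => k _; exact: sqr_ge0.
  - by rewrite IF.
  - move=> x xr; have [h1 h2] := cutoff1 hphi xr.
    rewrite le_eqVlt; apply/orP; left; apply/eqP; congr (_ * _); apply: eq_bigr => k _.
    by rewrite h1 h2 mul1r mulr0 addr0.
have [c hc] : exists c, forall x, du j x * (v x)^-1 = c.
  apply: (C1_grad0 (C1M (Cdu j) (C1V Cv v_neq0))) => i x.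
  have := K0 i x; rewrite /K => /eqP; rewrite subr_eq0 => /eqP ->.
  by field; rewrite v_neq0.
by exists c => x; rewrite -(hc x) mulfVK.
Qed.

End stable.

(** * Functions of the first block of variables and slices *)

Section slice.
Context {R : realType}.
Variables d s : nat.

Lemma lsubmx_shiftl h (i : 'I_d) (x : 'rV[R]_(d + s)) :
  lsubmx (h *: e_ (lshift s i) + x) = h *: e_ i + lsubmx x.
Proof.
by apply/rowP => k; rewrite e_coord [LHS]mxE e_coord mxE (inj_eq (@lshift_inj _ _)).
Qed.

Lemma lsubmx_shiftr h (j : 'I_s) (x : 'rV[R]_(d + s)) :
  lsubmx (h *: e_ (rshift d j) + x) = lsubmx x.
Proof.
by apply/rowP => k; rewrite mxE e_coord eq_lrshift mulr0 add0r mxE.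
Qed.

Lemma continuous_comp_lsubmx (g : 'rV[R]_d -> R) : continuous g ->
  continuous (fun x : 'rV[R]_(d + s) => g (lsubmx x)).
Proof.
move=> cg x; have cl : continuous (@lsubmx R 1 d s).
  apply: continuous_lip => a e e0; exists e => // b hb k; rewrite !mxE; exact: hb.
exact: (continuous_comp (cl x) (cg (lsubmx x))).
Qed.

Definition grad_lsubmx (dg : 'I_d -> 'rV[R]_d -> R) (i : 'I_(d + s)) (x : 'rV[R]_(d + s)) : R :=
  if fintype.split i is inl k then dg k (lsubmx x) else 0.

Lemma grad_lsubmx_l dg i x : grad_lsubmx dg (lshift s i) x = dg i (lsubmx x).
Proof. by rewrite /grad_lsubmx (unsplitK (inl _ i)). Qed.

Lemma grad_lsubmx_r dg j x : grad_lsubmx dg (rshift d j) x = 0.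
Proof. by rewrite /grad_lsubmx (unsplitK (inr _ j)). Qed.

Lemma C1_lsubmx g dg : C1 g dg -> C1 (fun x : 'rV[R]_(d + s) => g (lsubmx x)) (grad_lsubmx dg).
Proof.
move=> [cg D cdg]; split; first exact: continuous_comp_lsubmx.
  move=> i x; case: (split_ordP i) => [k ->|k ->].
    rewrite grad_lsubmx_l; apply: (is_derive_line _ (D k (lsubmx x))) => h.
    by rewrite lsubmx_shiftl.
  rewrite grad_lsubmx_r; apply: (is_derive_line _ (is_derive_cst (g (lsubmx x)) x (e_ (rshift d k)))) => h.
  by rewrite lsubmx_shiftr.
move=> i; case: (split_ordP i) => [k ->|k ->].
  rewrite (_ : grad_lsubmx _ _ = fun x => dg k (lsubmx x)); first exact: continuous_comp_lsubmx.
  by apply/funext => x; rewrite grad_lsubmx_l.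
rewrite (_ : grad_lsubmx _ _ = cst 0); first exact: cst_continuous.
by apply/funext => x; rewrite grad_lsubmx_r.
Qed.

Variable j1 : 'I_s.

(** The subspace spanned by the first d coordinates and the coordinate j1 of the
second block; [slice_ord] is the corresponding inclusion of coordinates. *)
Definition slice_emb (y : 'rV[R]_(d + 1)) : 'rV[R]_(d + s) :=
  row_mx (lsubmx y) (y 0 (rshift d ord0) *: e_ j1).

Definition slice_ord (i : 'I_(d + 1)) : 'I_(d + s) :=
  match fintype.split i with inl k => lshift s k | inr _ => rshift d j1 end.

Lemma slice_ord_l i : slice_ord (lshift 1 i) = lshift s i.
Proof. by rewrite /slice_ord (unsplitK (inl _ i)). Qed.

Lemma slice_ord_r i : slice_ord (rshift d i) = rshift d j1.
Proof. by rewrite /slice_ord (unsplitK (inr _ i)). Qed.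

Lemma slice_emb_l y k : slice_emb y 0 (lshift s k) = y 0 (lshift 1 k).
Proof. by rewrite row_mxEl mxE. Qed.

Lemma slice_emb_r y k : slice_emb y 0 (rshift d k) = y 0 (rshift d ord0) * (k == j1)%:R.
Proof. by rewrite row_mxEr !mxE eqxx. Qed.

Lemma slice_emb_transl h i y : slice_emb (h *: e_ i + y) = h *: e_ (slice_ord i) + slice_emb y.
Proof.
apply/rowP => k; rewrite e_coord; case: (split_ordP k) => [l ->|l ->].
  rewrite !slice_emb_l e_coord; case: (split_ordP i) => [m ->|m ->].
    by rewrite slice_ord_l !(inj_eq (@lshift_inj _ _)).
  by rewrite slice_ord_r !eq_lrshift.
rewrite !slice_emb_r e_coord; case: (split_ordP i) => [m ->|m ->].
  by rewrite slice_ord_l !eq_rlshift !mulr0 !add0r.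
by rewrite slice_ord_r !(inj_eq (@rshift_inj _ _)) !ord1 eqxx mulr1 mulrDl.
Qed.

Lemma continuous_slice (F : 'rV[R]_(d + s) -> R) z :
  continuous F -> continuous (fun y => F (z + slice_emb y)).
Proof.
move=> cF x; have cl : continuous slice_emb.
  apply: continuous_lip => a e e0; exists e => // b hb k.
  case: (split_ordP k) => [l ->|l ->]; first by rewrite !slice_emb_l.
  rewrite !slice_emb_r -mulrBl normrM; apply: le_lt_trans (hb (rshift d ord0)).
  by rewrite ler_piMr//; case: (l == j1); rewrite ?normr1 ?normr0.
exact: (continuous_comp (cl x) (continuous_transl (z := z) cF (x := slice_emb x))).
Qed.

Lemma C1_slice F dF z : C1 F dF ->
  C1 (fun y => F (z + slice_emb y)) (fun i y => dF (slice_ord i) (z + slice_emb y)).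
Proof.
move=> [cF D cdF]; split.
- exact: continuous_slice.
- move=> i y; apply: (is_derive_line _ (D (slice_ord i) (z + slice_emb y))) => h.
  by rewrite slice_emb_transl addrCA.
- by move=> i; exact: continuous_slice.
Qed.

End slice.

(** * Consequences of the growth hypothesis *)

Section growth.
Context {R : realType}.

(** The hypotheses bound the mass from above only. This lower bound shows that k
and g are positive in the range of radii under consideration. *)
Lemma ball_integral_gt0 d (gamma : 'rV[R]_d -> R) : continuous gamma ->
  (forall x, 0 < gamma x) ->
  exists2 c, 0 < c & forall r M, 1 < r -> (ball_integral gamma (2 * r) <= M%:E)%E -> c <= M.
Proof.
move=> cg g0; have hc := bump_cutoff d (@ltr01 R).
pose F x := gamma x * bump 1 x.
have ccF : ccont F by apply: ccontMl => //; exact: cutoff_ccont hc.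
have F0 x : 0 <= F x by rewrite mulr_ge0 ?(ltW (g0 _))//; have /andP[] := cutoff_itv hc x.
exists (Rn_int F) => [|r M r1 hM].
  rewrite ltNge; apply/negP => /(Rn_int_eq0 ccF F0)/(_ 0) /eqP.
  have Q0 : sqnorm (0 : 'rV[R]_d) <= 1 by rewrite /sqnorm big1// => i _; rewrite mxE expr0n.
  by rewrite /F; have [-> _] := cutoff1 hc Q0; rewrite mulr1 gt_eqF.
rewrite -lee_fin; apply: le_trans hM; apply: ball_integral_ge => //.
- by move=> x; exact: ltW.
- move=> x; rewrite F0 /= ler_piMr ?(ltW (g0 _))//; by have /andP[] := cutoff_itv hc x.
- move=> x h; have h4 : 4 * 1 <= sqnorm x.
    by apply: le_trans h; have := mulr_gt0 (lt_trans ltr01 r1) (lt_trans ltr01 r1); nra.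
  by have [e _] := bump_outside ltr01 h4; rewrite /F e mulr0.
Qed.

Lemma mass_le_weaken n (W : 'rV[R]_n -> R) r m m' : m <= m' -> mass_le W r m -> mass_le W r m'.
Proof. by move=> mm h F h1 h2 h3; exact: le_trans (h F h1 h2 h3) mm. Qed.

(** The s remaining variables contribute a factor (4r)^s. In the first alternative
s <= 4 and in the second s <= 3 with one more power of r from the hypothesis, so
both lead to the same bounds. *)
Lemma growth_mass_le d s (gamma : 'rV[R]_d -> R) (g : R -> R) (k : R) :
  continuous gamma -> (forall x, 0 < gamma x) -> class_G g ->
  ((forall r, 1 < r -> (ball_integral gamma (2 * r) <= (k * g r)%:E)%E) /\ (d + s <= d + 4)%N) \/
  ((forall r, 1 < r -> (ball_integral gamma (2 * r) <= (k * r * g r)%:E)%E) /\ (d + s <= d + 3)%N) ->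
  [/\ 0 < k, exists2 c, 0 < c & forall r, 1 < r -> c <= g r,
     forall r, 1 < r -> mass_le (fun x : 'rV[R]_(d + s) => gamma (lsubmx x)) (2 * r)
       (256 * k * r ^+ 4 * g r)
   & forall r, 1 < r -> mass_le (fun x : 'rV[R]_(d + 1) => gamma (lsubmx x)) (2 * r)
       (4 * k * r ^+ 2 * g r)].
Proof.
move=> cg g0 [gge0 gmono _] growth.
have [c c0 hc] := ball_integral_gt0 cg g0.
have g_ge0 r : 1 < r -> 0 <= g r by move=> r1; apply: gge0; exact: lt_trans r1.
have gx x : 0 <= gamma x by exact: ltW.
have mb t r M : 1 < r -> (ball_integral gamma (2 * r) <= M%:E)%E ->
    mass_le (fun x : 'rV[R]_(d + t) => gamma (lsubmx x)) (2 * r) ((4 * r) ^+ t * M).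
  move=> r1 hM; have r0 : 0 < r by exact: lt_trans r1.
  have := @mass_le_ball R d t gamma (2 * r) M (mulr_gt0 (ltr0n _ 2) r0) cg gx hM.
  by rewrite mulrA -natrM.
have pw t p (r : R) : (t <= p)%N -> 1 < r -> (4 * r) ^+ t <= (4 * r) ^+ p.
  by move=> tp r1; apply: ler_weXn2l => //; lra.
have two1 : 1 < 2 :> R by rewrite ltr1n.
case: growth => -[hM ds].
- have ck r : 1 < r -> c <= k * g r by move=> r1; exact: hc (hM _ r1).
  have k0 : 0 < k.
    rewrite ltNge; apply/negP => k0; have := ck 2 two1; have := g_ge0 2 two1; nra.
  split=> //.
  + exists (c / k); first exact: divr_gt0.
    by move=> r r1; rewrite ler_pdivrMr// mulrC; exact: ck.
  + move=> r r1; apply: mass_le_weaken (mb s r _ r1 (hM r r1)).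
    have kg : 0 <= k * g r by rewrite mulr_ge0 ?g_ge0// ltW.
    apply: (le_trans (ler_wpM2r kg (pw s 4%N r _ r1))); first by move: ds; rewrite leq_add2l.
    by rewrite le_eqVlt; apply/orP; left; apply/eqP; ring.
  + move=> r r1; apply: mass_le_weaken (mb 1%N r _ r1 (hM r r1)).
    have kg : 0 <= k * g r by rewrite mulr_ge0 ?g_ge0// ltW.
    rewrite expr1; have : 0 <= k * g r * (r * (r - 1)).
      by rewrite mulr_ge0// mulr_ge0//; lra.
    move: (g r) => X; lra.
- have ck r : 1 < r -> c <= k * r * g r by move=> r1; exact: hc (hM _ r1).
  have k0 : 0 < k.
    rewrite ltNge; apply/negP => k0; have := ck 2 two1; have := g_ge0 2 two1; nra.
  split=> //.
  + exists (c / (2 * k)); first by rewrite divr_gt0// mulr_gt0.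
    move=> r r1; rewrite ler_pdivrMr ?mulr_gt0//.
    have [r2|/ltW r2] := leP r 2.
      apply: (le_trans (ck r r1)); have := g_ge0 r r1 => gr.
      have : 0 <= k * g r * (2 - r) by rewrite !mulr_ge0 ?subr_ge0// ltW.
      by move: (ck r r1); lra.
    have gr : g 2 <= g r by apply: gmono.
    apply: (le_trans (ck 2 two1)).
    have : 0 <= k * (g r - g 2) by rewrite mulr_ge0 ?subr_ge0// ltW.
    lra.
  + move=> r r1; apply: mass_le_weaken (mb s r _ r1 (hM r r1)).
    have r0 : 0 < r by exact: lt_trans r1.
    have kg : 0 <= k * r * g r by rewrite !mulr_ge0 ?g_ge0// ltW.
    apply: (le_trans (ler_wpM2r kg (pw s 3%N r _ r1))); first by move: ds; rewrite leq_add2l.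
    have : 0 <= k * r ^+ 4 * g r by rewrite !mulr_ge0 ?exprn_ge0 ?g_ge0// ltW.
    rewrite (_ : (4 * r) ^+ 3 * (k * r * g r) = 64 * (k * r ^+ 4 * g r)); last by ring.
    rewrite (_ : 256 * k * r ^+ 4 * g r = 256 * (k * r ^+ 4 * g r)); last by ring.
    by move: (k * _ * _) => X; lra.
  + move=> r r1; apply: mass_le_weaken (mb 1%N r _ r1 (hM r r1)).
    by rewrite le_eqVlt; apply/orP; left; apply/eqP; ring.
Qed.

End growth.

(** * The Liouville theorem *)

Section main.
Context {R : realType}.

Lemma class_C2_C1 n (u : 'rV[R]_n -> R) : class_C 2 u ->
  C1 u (fun i => partial i u) /\ forall i, C1 (partial i u) (fun k => partial k (partial i u)).
Proof.
move=> [cu h]; split; last by move=> i; apply: C1_class; case: (h i).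
apply: C1_class; split=> // i; split; first by case: (h i).
by case: (h i) => _ [].
Qed.

Lemma weighted_div_gradE d s (gamma : 'rV[R]_d -> R) dg (u : 'rV[R]_(d + s) -> R) du ddu x :
  C1 gamma dg -> C1 u du -> (forall i, C1 (du i) (ddu i)) ->
  weighted_div_grad gamma u x =
  \sum_i (gamma (lsubmx x) * ddu i i x + du i x * grad_lsubmx dg i x).
Proof.
move=> Cg Cu Cdu; apply: eq_bigr => i _.
have E : partial i u = du i by apply/funext => y; exact: C1_partial Cu.
by rewrite E (C1_partial i x (C1M (C1_lsubmx s Cg) (Cdu i))).
Qed.

(** [caccioppoli] with a bump between radii r and 2r: the energy in the ball of
radius r gains a factor 1/r^2 over the mass of w in the ball of radius 2r. *)
Lemma mass_le_gradient n (w : 'rV[R]_n -> R) u du fl (m B r M : R) (j : 'I_n) :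
  0 < r -> continuous w -> (forall x, 0 <= w x) ->
  C1 u du -> (forall i, C1 (fun x => w x * du i x) (fl i)) ->
  (forall x, 0 <= (\sum_i fl i i x) * (u x - m)) ->
  (forall x, `|u x - m| <= B) -> mass_le w (2 * r) M ->
  mass_le (fun x => w x * du j x ^+ 2) r (4 * B ^+ 2 * (16 / r ^+ 2 * M)).
Proof.
move=> r0 cw w0 Cu Cfl eq uB hM F ccF FW FQ.
have r20 : 0 < r ^+ 2 by rewrite exprn_gt0.
have hc := bump_cutoff n r20; have [_ _ cdu] := Cu.
have c0 : forall i : 'I_n, 0 <= (1 : R) by [].
have eq1 x : 0 <= (\sum_i 1 * fl i i x) * (u x - m).
  by under eq_bigr do rewrite mul1r.
have := @caccioppoli R n (fun=> 1) w u du fl m B _ _ _ c0 cw w0 Cu Cfl eq1 uB hc.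
under [in leRHS]eq_Rn_int do under eq_bigr do rewrite mul1r.
move=> /le_trans H; apply: le_trans (H _ _); last first.
  by apply: ler_wpM2l; [rewrite mulr_ge0// sqr_ge0|exact: Rn_int_bump_grad].
apply: le_Rn_int => //.
  apply: ccontMl; last by apply: ccont_sqr; exact: cutoff_ccont hc.
  apply: continuous_mul => //; apply: continuous_bigsum => i.
  by apply: continuous_mul; [exact: cst_continuous|exact: continuous_sqr].
move=> x; have [h|/ltW h] := leP (r ^+ 2) (sqnorm x).
  rewrite FQ// mulr_ge0 ?sqr_ge0// mulr_ge0//; apply: sumr_ge0 => i _.
  by rewrite mul1r sqr_ge0.
have [-> _] := cutoff1 hc h; rewrite expr1n mulr1.
have /andP[_ Fx] := FW x; apply: (le_trans Fx); rewrite ler_wpM2l//.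
rewrite (bigD1 j)//= mul1r lerDl; apply: sumr_ge0 => i _.
by rewrite mul1r sqr_ge0.
Qed.

End main.

Theorem theorem1 (R : realType) (d s : nat) (hd : (1 <= d)%N) (hs : (1 <= s)%N)
    (gamma lambda : 'rV[R]_d -> R)
    (gamma_smooth : smooth gamma) (gamma_gt0 : forall x, 0 < gamma x)
    (lambda_smooth : smooth lambda)
    (lambda_gt0 : exists x0, 0 <= lambda x0 /\ forall x, x != x0 -> 0 < lambda x)
    (f : R -> R)
    (f_derivable : forall t, derivable f t 1) (f_C1 : continuous (derive1 f))
    (u : 'rV[R]_(d + s) -> R)
    (u_bounded : exists M, forall x, `|u x| <= M)
    (u_solution : classical_solution gamma lambda f u)
    (u_stable : pointwise_stable gamma lambda f u)
    (f_sign : (forall t, range u t -> 0 <= f t) \/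
              (forall t, range u t -> t * f t <= 0))
    (g : R -> R) (hg : class_G g) (k : R)
    (growth :
      ((forall r, 1 < r -> (ball_integral gamma (2 * r) <= (k * g r)%:E)%E) /\
         (d + s <= d + 4)%N) \/
      ((forall r, 1 < r -> (ball_integral gamma (2 * r) <= (k * r * g r)%:E)%E) /\
         (d + s <= d + 3)%N)) :
  exists c, forall x, u x = c.
Proof.
have Cgamma := C1_class (gamma_smooth 1%N).
have cgamma : continuous gamma by case: Cgamma.
have clambda : continuous lambda by case: (lambda_smooth 0%N).
have lambda_ge0 x : 0 <= lambda x.
  have [x0 [l0 lx]] := lambda_gt0; have [->//|/lx/ltW//] := eqVneq x x0.
have [k0 [c1 c10 hc1] massn mass1] := growth_mass_le cgamma gamma_gt0 hg growth.
have hser := class_G_series hg c10 hc1.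
have gpos r : 1 < r -> 0 < g r by move=> /hc1; exact: lt_le_trans.
have two1 p : 1 < 2 ^+ p.+1 :> R by rewrite exprn_egt1// ltr1n.
pose w x : R := gamma (lsubmx (x : 'rV[R]_(d + s))).
pose la x : R := lambda (lsubmx (x : 'rV[R]_(d + s))).
have [u_C2 eq] := u_solution; have [Cu Cdu] := class_C2_C1 u_C2.
have [v [v_C2 v0 eqv]] := u_stable; have [Cv Cdv] := class_C2_C1 v_C2.
pose du i := partial i u; pose ddu i l := partial l (du i).
pose dw := grad_lsubmx (s := s) (fun i => partial i gamma).
have Cw : C1 w dw by exact: C1_lsubmx.
have cw : continuous w by case: Cw.
have w0 x : 0 < w x by exact: gamma_gt0.
have {}eq x : - (\sum_i (w x * ddu i i x + du i x * dw i x)) = la x * f (u x).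
  by rewrite -(weighted_div_gradE x Cgamma Cu Cdu) eq.
have {}eqv x : - (\sum_i (w x * partial i (partial i v) x + partial i v x * dw i x))
    = la x * derive1 f (u x) * v x.
  by rewrite -(weighted_div_gradE x Cgamma Cv Cdv) eqv.
(* Testing with u - m gives the zero-order term a sign: m bounds u from above in
   the first case of f_sign, and is 0 in the second. *)
have [m [B [eqm uB]]] : exists m B, (forall x, la x * f (u x) * (u x - m) <= 0) /\
    forall x, `|u x - m| <= B.
  have [M hM] := u_bounded; case: f_sign => fs.
    exists M, (M + M); split=> x.
      apply: mulr_ge0_le0; last by rewrite subr_le0; apply: le_trans (hM x); exact: ler_norm.
      by apply: mulr_ge0; [exact: lambda_ge0|apply: (fs (u x)); exists x].
    have M0 : 0 <= M by apply: le_trans (hM 0).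
    by apply: le_trans (ler_normB _ _) _; rewrite (ger0_norm M0) lerD2r.
  exists 0, M; split=> x; rewrite subr0//.
  rewrite -mulrA; apply: mulr_ge0_le0; first exact: lambda_ge0.
  by rewrite mulrC; apply: (fs (u x)); exists x.
pose fl (i l : 'I_(d + s)) x := w x * ddu i l x + du i x * dw l x.
have Cfl i : C1 (fun x => w x * du i x) (fl i) by exact: C1M Cw (Cdu i).
have eqm' x : 0 <= (\sum_i fl i i x) * (u x - m).
  by rewrite -oppr_le0 -mulNr eq; exact: eqm.
have dw_r (j : 'I_s) x : dw (rshift d j) x = 0 by exact: grad_lsubmx_r.
have flr (j : 'I_s) x : fl (rshift d j) (rshift d j) x = w x * ddu (rshift d j) (rshift d j) x.
  by rewrite /fl dw_r mulr0 addr0.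
(* The weight w du_j^2 has mass O(r^2 g(r)): the energy gains a factor r^-2 over
   the mass O(r^4 g(r)) of gamma. *)
have prop (j : 'I_s) : exists c, forall x, du (rshift d j) x = c * v x.
  have hw h x : w (h *: e_ (rshift d j) + x) = w x by rewrite /w lsubmx_shiftr.
  have hla h x : la (h *: e_ (rshift d j) + x) = la x by rewrite /la lsubmx_shiftr.
  have cla : continuous la by exact: (continuous_comp_lsubmx (s := s) clambda).
  pose C := 4 * B ^+ 2 * 16 * (256 * k) * 16.
  have C0 : 0 <= C.
    have k256 : 0 <= 256 * k := mulr_ge0 (ler0n _ 256) (ltW k0).
    exact: mulr_ge0 (mulr_ge0 (mulr_ge0 (mulr_ge0 (ler0n _ 4) (sqr_ge0 B)) (ler0n _ 16)) k256) (ler0n _ 16).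
  have b0 p : 0 < g (2 ^+ p.+2) by exact: gpos (two1 p.+1).
  have hmass p : mass_le (fun x => w x * du (rshift d j) x ^+ 2) (2 ^+ p.+2) (C * 4 ^+ p * g (2 ^+ p.+2)).
    have r0 : 0 < 2 ^+ p.+2 :> R by rewrite exprn_gt0.
    have h := @mass_le_gradient R _ w u du fl m B (2 ^+ p.+2) _ (rshift d j) r0 cw (fun x => ltW (w0 x))
      Cu Cfl eqm' uB (massn _ (two1 p.+1)).
    apply: mass_le_weaken h; rewrite le_eqVlt; apply/orP; left; apply/eqP.
    have E4 : (4 : R) ^+ p = (2 ^+ p) ^+ 2 by rewrite -exprM mulnC exprM -[in RHS]natrX.
    have x0 : 0 < 2 ^+ p :> R by rewrite exprn_gt0.
    rewrite /C E4; move: (g _) => G; rewrite [2 ^+ p.+2]exprS [2 ^+ p.+1]exprS.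
    move: (2 ^+ p : R) x0 => X X0; field.
    by rewrite gt_eqF.
  have ser A : exists N, A <= \sum_(p < N) (g (2 ^+ p.+2))^-1.
    have [N hN] := hser (A + (g (2 ^+ 1))^-1); exists N.
    have : A + (g (2 ^+ 1))^-1 <= \sum_(p < N.+1) (g (2 ^+ p.+1))^-1.
      by apply: (le_trans hN); rewrite big_ord_recr /= lerDl invr_ge0 ltW// gpos.
    by rewrite big_ord_recl addrC lerD2l.
  exact: (@stable_liouville R _ w la u v dw f du ddu (fun i => partial i v)
      (fun i l => partial l (partial i v)) (rshift d j) C (fun p => g (2 ^+ p.+2))
      Cw w0 hw cla hla f_derivable f_C1 Cu Cdu eq Cv Cdv v0 eqv C0 b0 hmass ser).
have [a ha] : exists a : 'I_s -> R, exists j1, forall j x,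
    du (rshift d j) x = a j * du (rshift d j1) x.
  have /choice[c hc] := prop.
  (* If all the c j vanish, so do these derivatives, and any j1 will do. *)
  have [[j1 cj1]|/forallNP h] := pselect (exists j1, c j1 != 0).
    exists (fun j => c j / c j1), j1 => j x.
    by rewrite !hc mulrA divfK.
  exists (fun=> 0), (Ordinal hs) => j x; rewrite hc mul0r.
  by have /negP := h j; rewrite negbK => /eqP ->; rewrite mul0r.
have [j1 {}ha] := ha.
(* kappa is 0 when the derivatives in the second block vanish identically; the
   final argument covers this case. *)
pose kappa := \sum_j a j ^+ 2.
have kappa0 : 0 <= kappa by apply: sumr_ge0 => j _; exact: sqr_ge0.
have lap x : \sum_j ddu (rshift d j) (rshift d j) x = kappa * ddu (rshift d j1) (rshift d j1) x.
  rewrite mulr_suml; apply: eq_bigr => j _.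
  have E (l : 'I_(d + s)) : ddu (rshift d j) l x = a j * ddu (rshift d j1) l x.
    have -> : ddu (rshift d j) l x = partial l (fun y => a j * du (rshift d j1) y) x.
      by congr (partial l _ x); apply/funext => y; exact: ha.
    exact: (C1_partial l x (C1Z (a j) (Cdu (rshift d j1)))).
  have sym : ddu (rshift d j1) (rshift d j) x = ddu (rshift d j) (rshift d j1) x.
    exact: schwarz x Cu (Cdu (rshift d j1)) (Cdu (rshift d j)).
  rewrite E sym E.
  by rewrite mulrA -expr2.
(* By proportionality of the derivatives in the second block, its Laplacian is
   kappa times the second derivative in the direction j1. So u restricted to a
   slice solves an equation of the same kind in dimension d + 1, where gamma has
   mass O(r^2 g(r)). The slice passes through a point z with zero first block so
   that gamma keeps its variables. *)
have slice0 (z : 'rV[R]_(d + s)) : lsubmx z = 0 -> forall y,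
   (forall i, du (lshift s i) (z + slice_emb j1 y) = 0) /\
   kappa * du (rshift d j1) (z + slice_emb j1 y) ^+ 2 = 0.
  move=> z0.
  have lsl y : lsubmx (z + slice_emb j1 y) = lsubmx y.
    by apply/rowP => i; rewrite mxE mxE slice_emb_l; move/rowP/(_ i): z0; rewrite !mxE => ->; rewrite add0r.
  pose W y := w (z + slice_emb j1 y); pose U y := u (z + slice_emb j1 y).
  pose io := slice_ord (d := d) j1.
  pose dU i y := du (io i) (z + slice_emb j1 y).
  pose c (i : 'I_(d + 1)) : R := if fintype.split i is inl _ then 1 else kappa.
  have c_l i : c (lshift 1 i) = 1 by rewrite /c (unsplitK (inl _ i)).
  have c_r i : c (rshift d i) = kappa by rewrite /c (unsplitK (inr _ i)).
  have c_ge0 i : 0 <= c i by rewrite /c; case: fintype.split.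
  have CW := C1_slice j1 z Cw; have CU := C1_slice j1 z Cu.
  have CdU i := C1_slice j1 z (Cdu (io i)).
  have CflU i := C1M CW (CdU i).
  have cW : continuous W by case: CW.
  have W0 y : 0 < W y by exact: w0.
  have eqU y : 0 <= (\sum_i c i * (W y * ddu (io i) (io i) (z + slice_emb j1 y) +
        dU i y * dw (io i) (z + slice_emb j1 y)))
      * (U y - m).
    have -> : \sum_i c i * (W y * ddu (io i) (io i) (z + slice_emb j1 y) +
        dU i y * dw (io i) (z + slice_emb j1 y))
       = \sum_i fl i i (z + slice_emb j1 y).
      rewrite !big_split_ord /= big_ord1 c_r; congr (_ + _).
        by apply: eq_bigr => i _; rewrite c_l mul1r /dU /io slice_ord_l.
      rewrite [RHS](eq_bigr _ (fun j _ => flr j _)) -mulr_sumr lap /io slice_ord_r dw_r.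
      by rewrite mulr0 addr0 mulrCA.
    exact: eqm'.
  have UB y : `|U y - m| <= B by exact: uB.
  have massW p : mass_le W (2 ^+ p.+2) (16 * k * 4 ^+ p * g (2 ^+ p.+1)).
    have -> : W = (fun y => gamma (lsubmx y)) by apply/funext => y; rewrite /W /w lsl.
    rewrite exprS; apply: mass_le_weaken (mass1 _ (two1 p)).
    have E4 : (4 : R) ^+ p = (2 ^+ p) ^+ 2 by rewrite -exprM mulnC exprM -[in RHS]natrX.
    rewrite E4 le_eqVlt; apply/orP; left; apply/eqP; move: (g _) => G.
    by rewrite [2 ^+ p.+1]exprS; ring.
  have S0 := @energy_liouville R _ c W U dU _ m B (16 * k) (fun p => g (2 ^+ p.+1))
    c_ge0 cW W0 CU CflU eqU UB (mulr_ge0 (ler0n _ 16) (ltW k0)) (fun p => gpos _ (two1 p))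
    massW hser.
  move=> y.
  split=> [i|].
    by have /eqP := S0 (lshift 1 i) y; rewrite c_l mul1r sqrf_eq0 /dU /io slice_ord_l => /eqP.
  by have := S0 (rshift d ord0) y; rewrite c_r /dU /io slice_ord_r.
apply: (C1_grad0 Cu) => i x.
pose z : 'rV[R]_(d + s) := row_mx 0 (rsubmx x).
pose y : 'rV[R]_(d + 1) := row_mx (lsubmx x) 0.
have xE : x = z + slice_emb j1 y.
  by rewrite /z /slice_emb /y row_mxKl row_mxEr mxE scale0r add_row_mx add0r addr0 hsubmxK.
have z0 : lsubmx z = 0 by rewrite row_mxKl.
have [h1 h2] := slice0 z z0 y.
rewrite -xE in h1 h2.
case: (split_ordP i) => [l ->|j ->]; first exact: h1.
have : \sum_j du (rshift d j) x ^+ 2 = 0.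
  by rewrite -[RHS]h2 mulr_suml; apply: eq_bigr => l _; rewrite ha exprMn.
move/eqP; rewrite psumr_eq0; last by move=> l _; exact: sqr_ge0.
by move=> /allP/(_ j); rewrite mem_index_enum => /(_ isT); rewrite /= sqrf_eq0 => /eqP.
Qed.
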